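(* Let $E\subset\mathbb{R}^d$ be closed and $N\ge1$. For all $F^N,G^N\in\mathbf{P}_{sym}(E^N)$, $$W_1(F^N,G^N)=\mathcal{W}_1(\hat F^N,\hat G^N).$$
   Context: $\mathbf{P}(Z)$: Borel probability measures on $Z$; $\mathbf{P}_{sym}(E^N)$: those on $E^N$ invariant under permutations of coordinates. $W_1$ is the Monge-Kantorovich-Wasserstein distance (exponent 1) on $\mathbf{P}(E^j)$, $j\ge 1$, for the normalized cost $d_{E^j}(X,Y):=\frac1j\sum_{i=1}^j\min(|x_i-y_i|,1)$. $\mathcal{W}_1$ is the Monge-Kantorovich-Wasserstein distance (exponent 1) on $\mathbf{P}(\mathbf{P}(E))$ for the cost $W_1$ on $\mathbf{P}(E)$: $\mathcal{W}_1(\alpha,\beta):=\inf_\pi\int W_1(\rho,\eta)\,\pi(d\rho,d\eta)$ over couplings $\pi$ of $\alpha$ and $\beta$. For $G^N\in\mathbf{P}(E^N)$, $\hat G^N\in\mathbf{P}(\mathbf{P}(E))$ denotes the push-forward of $G^N$ under the empirical measure map $X=(x_1,\dots,x_N)\mapsto\mu^N_X:=\frac1N\sum_{i=1}^N\delta_{x_i}$. *)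

(* Defs.v *)
From HB Require Import structures.
From mathcomp Require Import all_boot all_order all_algebra perm.
From mathcomp Require Import all_classical all_reals all_analysis.
From mathcomp Require Import measurable_realfun.

Set Implicit Arguments.
Unset Strict Implicit.
Unset Printing Implicit Defensive.
Import Order.TTheory GRing.Theory Num.Theory.
Import numFieldNormedType.Exports.

Local Open Scope classical_set_scope.
Local Open Scope ring_scope.

HB.instance Definition _ (I : Type) (T : I -> ptopologicalType) :=
  Pointed.copy (prod_topology T) (forall i : I, T i).
HB.instance Definition _ (T U : ptopologicalType) := Pointed.on (T * U)%type.

Lemma ptws_continuous (T U : topologicalType) (I : Type)
    (f : T -> {ptws I -> U}) :
  (forall i, continuous (fun x => f x i)) -> continuous f.
Proof.
move=> cf x; apply/cvg_sup => i.
move: x; apply/(@continuousP _ (initial_topology (@^~ i))) => A [B oB <-].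
by have /continuousP := cf i; exact.
Qed.

Lemma average_continuous (R : realType) (T : topologicalType) (f : T -> R)
    (N : nat) : continuous f ->
  continuous (fun X : {ptws 'I_N -> T} => N%:R^-1 * \sum_(i < N) f (X i)).
Proof.
move=> cf.
have cs : continuous (fun X : {ptws 'I_N -> T} => \sum_(i < N) f (X i)).
  apply: (continuous_big (@add_continuous R)) => i _ X.
  apply: (@continuous_comp {ptws 'I_N -> T} _ _ (fun X => X i)); last exact: cf.
  exact: (@proj_continuous _ (fun=> T) i).
move=> X; apply: (@cvgMl_tmp R _ _ (nbhs_filter X) _ N%:R^-1 _ (cs X)).
Qed.

(* The subtype of E; the library's measurable types are pointed, hence the
   witness [E0] (there is no probability measure on the empty set). *)
Definition nonempty_subset (T : topologicalType) (E : set T) (E0 : E !=set0) :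
  Type := set_type E.

HB.instance Definition _ (T : topologicalType) (E : set T) (E0 : E !=set0) :=
  Topological.copy (nonempty_subset E0) (set_type E).
HB.instance Definition _ (T : topologicalType) (E : set T) (E0 : E !=set0) :=
  isPointed.Build (nonempty_subset E0)
    (exist _ (projT1 (cid E0)) (mem_set (projT2 (cid E0)))).

Definition borelType (Z : ptopologicalType) := g_sigma_algebraType (@open Z).
HB.instance Definition _ (Z : ptopologicalType) :=
  Measurable.on (borelType Z).

Definition borel (Z : ptopologicalType) : set (set Z) :=
  @measurable _ (borelType Z).

Lemma continuous_borel_measurable (Z1 Z2 : ptopologicalType) (f : Z1 -> Z2) :
  continuous f ->
  measurable_fun [set: borelType Z1] (f : borelType Z1 -> borelType Z2).
Proof.
move=> /continuousP cf.
apply: (@measurability _ _ (borelType Z1) (borelType Z2) _ _ (@open Z2)) => //.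
by move=> _ [B oB <-]; rewrite setTI; apply: sub_sigma_algebra; exact: cf.
Qed.

Lemma continuous_borel_measurableR (R : realType) (Z : ptopologicalType)
    (f : Z -> R) : continuous f ->
  measurable_fun [set: borelType Z] (f : borelType Z -> R).
Proof.
move=> /continuousP cf; apply: (measurability _ (RGenOpens.measurableE R)).
move=> _ [_ [a [b ->] <-]]; rewrite setTI; apply: sub_sigma_algebra.
exact/cf/interval_open.
Qed.

Section probability_space.
Variables (R : realType) (Z : ptopologicalType).

Definition Prob : Type := probability (borelType Z) R.
HB.instance Definition _ := Choice.on Prob.
HB.instance Definition _ := Pointed.on Prob.

Definition bounded_continuous : Type :=
  {f : Z -> R | continuous f /\ exists M : R, forall z, `|f z| <= M}.

Definition Prob_test (mu : Prob) : {ptws bounded_continuous -> R} :=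
  fun f => \int[mu]_(z in [set: borelType Z]) sval f z.

(* [Prob] carries the topology of weak convergence: the coarsest one making
   mu |-> \int f dmu continuous for every bounded continuous f. *)
HB.instance Definition _ := Topological.copy Prob (initial_topology Prob_test).

End probability_space.

Section wasserstein.
Variables (R : realType) (Z : ptopologicalType).

Definition coupling (mu nu : Prob R Z) : set (Prob R (Z * Z)%type) :=
  [set pi | forall A, borel A ->
    pi (fst @^-1` A) = mu A /\ pi (snd @^-1` A) = nu A].

Definition wasserstein (c : Z -> Z -> \bar R) (mu nu : Prob R Z) : \bar R :=
  ereal_inf [set (\int[pi]_(z in [set: borelType (Z * Z)%type]) c z.1 z.2)%E
            | pi in coupling mu nu].

End wasserstein.

Section statement_notions.
Variables (R : realType) (d : nat) (E : set 'rV[R]_d) (E0 : E !=set0).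

Let Et := nonempty_subset E0.
Let EN (N : nat) := {ptws 'I_N -> Et}.

(* The library's norm on ['rV[R]_d] is the sup norm, not the Euclidean one. *)
Definition euclidean_norm (v : 'rV[R]_d) : R :=
  Num.sqrt (\sum_(k < d) v 0 k ^+ 2).

Definition truncated_dist (x y : Et) : R :=
  Num.min (euclidean_norm (set_val x - set_val y)) 1.

Definition normalized_dist (j : nat) (X Y : EN j) : R :=
  j%:R^-1 * \sum_(i < j) truncated_dist (X i) (Y i).

Definition W1_pow (j : nat) : Prob R (EN j) -> Prob R (EN j) -> \bar R :=
  wasserstein (fun X Y => (normalized_dist X Y)%:E).

(* the case j = 1, with E^1 identified with E *)
Definition W1 : Prob R Et -> Prob R Et -> \bar R :=
  wasserstein (fun x y => (truncated_dist x y)%:E).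

Definition calW1 : Prob R (Prob R Et) -> Prob R (Prob R Et) -> \bar R :=
  wasserstein W1.

Definition symmetric_prob (N : nat) (F : Prob R (EN N)) : Prop :=
  forall (s : 'S_N) (A : set (EN N)), borel A ->
    F ((fun X : EN N => (fun i => X (s i)) : EN N) @^-1` A) = F A.

Section empirical.
Variables (N : nat) (N0 : (0 < N)%N).

Section empirical_measure.
Variable X : EN N.

(* [N0] only serves to make the total mass equal to 1. *)
Definition empirical_fun of (0 < N)%N := fun A : set (borelType Et) =>
  (N%:R^-1%:E * \sum_(i < N) @dirac _ (borelType Et) (X i) R A)%E.

Let comp (k : nat) : {measure set (borelType Et) -> \bar R} :=
  if insub k is Some i then @dirac _ (borelType Et) (X i) R else mzero.

Let invN_ge0 : 0 <= (N%:R^-1 : R). Proof. by rewrite invr_ge0. Qed.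

Lemma empirical_funE :
  empirical_fun N0 = mscale (NngNum invN_ge0) (msum comp N).
Proof.
apply/funext => A; rewrite /empirical_fun /mscale /msum; congr (_ * _)%E.
by apply: eq_bigr => i _; rewrite /comp valK.
Qed.

Let empirical0 : empirical_fun N0 set0 = 0%E.
Proof. by rewrite empirical_funE measure0. Qed.
Let empirical_ge0 A : (0 <= empirical_fun N0 A)%E.
Proof. by rewrite empirical_funE. Qed.
Let empirical_sigma_additive : semi_sigma_additive (empirical_fun N0).
Proof. rewrite empirical_funE; exact: measure_semi_sigma_additive. Qed.

HB.instance Definition _ := isMeasure.Build _ _ _ (empirical_fun N0)
  empirical0 empirical_ge0 empirical_sigma_additive.

Let empirical_setT : empirical_fun N0 setT = 1%E.
Proof.
rewrite /empirical_fun; under eq_bigr do rewrite diracT.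
rewrite sumEFin sumr_const card_ord -EFinM mulVf// pnatr_eq0.
by case: N N0.
Qed.

HB.instance Definition _ := Measure_isProbability.Build _ _ _
  (empirical_fun N0) empirical_setT.

Definition empirical : Prob R Et := empirical_fun N0.

Lemma ge0_integral_empirical (f : borelType Et -> \bar R) :
  measurable_fun setT f -> (forall x, 0 <= f x)%E ->
  (\int[empirical]_x f x = N%:R^-1%:E * \sum_(i < N) f (X i))%E.
Proof.
move=> mf f0.
rewrite (eq_measure_integral (mscale (NngNum invN_ge0) (msum comp N)));
  last first.
  by move=> A _ _; exact: (congr1 (@^~ A) (empirical_funE)).
rewrite ge0_integral_mscale// ge0_integral_measure_sum//; congr (_ * _)%E.
apply: eq_bigr => i _; rewrite /comp valK.
by rewrite integral_dirac// diracT mul1e.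
Qed.

End empirical_measure.

Lemma Rintegral_empirical (X : EN N) (f : Et -> R) : continuous f ->
  \int[empirical X]_(x in [set: borelType Et]) f x
  = N%:R^-1 * \sum_(i < N) f (X i).
Proof.
move=> cf; have mf := continuous_borel_measurableR cf.
have mEf : measurable_fun [set: borelType Et] (EFin \o f).
  exact/measurable_EFinP.
rewrite /Rintegral integralE.
rewrite ge0_integral_empirical; [|exact: measurable_funepos|by []].
rewrite ge0_integral_empirical; [|exact: measurable_funeneg|by []].
have pE i : ((EFin \o f)^\+ (X i))%E = (Num.max (f (X i)) 0)%:E.
  by rewrite funeposE /= EFin_max.
have nE i : ((EFin \o f)^\- (X i))%E = (Num.max (- f (X i)) 0)%:E.
  by rewrite funenegE /= EFin_max.
under eq_bigr do rewrite pE; under [X in (_ - _ * X)%E]eq_bigr do rewrite nE.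
rewrite !sumEFin -!EFinM -EFinB /= -mulrBr -sumrB; congr (_ * _)%R.
apply: eq_bigr => i _; case: (leP 0 (f (X i))) => fX.
  by rewrite max_r ?subr0// oppr_le0.
by rewrite max_l ?sub0r ?opprK// oppr_ge0 ltW.
Qed.

Lemma empirical_continuous : continuous (empirical : EN N -> Prob R Et).
Proof.
apply: (@continuous_comp_initial _ _ _ (@Prob_test R Et)) => X.
move: X; apply: ptws_continuous => -[f [cf bf]].
rewrite (_ : (fun X => _) =
    fun X : EN N => N%:R^-1 * \sum_(i < N) f (X i)); last first.
  by apply/funext => X; rewrite /= /Prob_test /= Rintegral_empirical.
exact: average_continuous.
Qed.

Let empirical_measurable :
  measurable_fun [set: borelType (EN N)]
    (empirical : borelType (EN N) -> borelType (Prob R Et)).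
Proof. exact: continuous_borel_measurable empirical_continuous. Qed.

HB.instance Definition _ := isMeasurableFun.Build _ _ _ _
  (empirical : borelType (EN N) -> borelType (Prob R Et)) empirical_measurable.

Definition empirical_law (G : Prob R (EN N)) : Prob R (Prob R Et) :=
  distribution G (empirical : borelType (EN N) -> borelType (Prob R Et)).

End empirical.
End statement_notions.

(* Main.v *)
From HB Require Import structures.
Require Import Defs.
From mathcomp Require Import all_boot all_order all_algebra perm.
From mathcomp Require Import all_classical all_reals all_analysis.
From mathcomp Require Import measurable_realfun.
From mathcomp Require Import ring lra.
Import numFieldNormedType.Exports.

(** Write [emp X] for the empirical measure of [X].

    One inequality is soft. A coupling of [F] and [G] is pushed forward by
    [emp] in both variables, and [W1 (emp X) (emp Y)] is at most the normalized
    distance of [X] and [Y], because the average of the Dirac masses at the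
    pairs [(x_i, y_i)] couples the two empirical measures
    ([W1_empirical_le], [calW1_empirical_le]).

    For the other inequality a coupling [Pi] of the two empirical laws has to
    be lifted to a coupling of [F] and [G]. Between empirical measures of [N]
    points, optimal transport is realized by a permutation (Birkhoff), so the
    lift should draw [(mu, nu)] from [Pi], list the atoms of [mu] and of [nu],
    rearrange the second list optimally, and shuffle both lists by a common
    uniform permutation. The shuffle does not change the cost, and it turns the
    list of atoms of [emp X], with [X] drawn from a symmetric [F], back into a
    sample of [F].

    A measurable listing of atoms and a disintegration are avoided by working
    up to an error [e]. The set [E] is cut into countably many cubic cells so
    small that the cost varies by at most [e] on a product of two cells
    ([cell_oscillation]), and atoms are replaced by the labels of their cells.
    Then lists of labels form a countable set, every choice is measurable, and
    a joint law of labels with the right marginals lifts to a coupling of [F]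
    and [G] by drawing the points independently given the labels
    ([glue_along_labels]). What remains to be seen is that
    - [mu |-> mu C] is Borel on the space of measures for every cell [C],
      because the indicator of [C] is a pointwise limit of bounded continuous
      functions ([measurable_eval_continuous_limit]);
    - the product sigma-algebra on [E^N * E^N], where Fubini is available,
      contains the Borel sets ([borel_prod_measurable]);
    - for measures that give to each cell the mass which an empirical measure
      gives to it, the cost between labels after the optimal rearrangement is
      at most [W1 + e] ([best_dist_le_W1]); this rests on the assignment
      inequality [assignment_le].
    Letting [e] tend to [0] finishes the proof.

    Integrals of [W1] against a law on pairs of measures are handled as lower
    integrals: the integral of a nonnegative function is a supremum over the
    simple functions below it, and this is monotone and does not increase under
    push-forward, for arbitrary functions ([le_lower_integral],
    [lower_integral_pushforward]). *)

Set Implicit Arguments.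
Unset Strict Implicit.
Unset Printing Implicit Defensive.
Import Order.TTheory GRing.Theory Num.Theory.
Local Open Scope ring_scope.

(** * Optimal assignments *)

Section assignment.
Variables (R : realFieldType) (V : finType).
Implicit Types (m w c : V -> V -> R) (s : {perm V}).

(** A minimal nonempty set C with f C included in C satisfies f C = C, so that
    f is injective on the finite set C and can be completed by the identity. *)
Lemma invariant_set_perm (f : V -> V) (A : {set V}) : A != finset.set0 ->
  f @: A \subset A ->
  exists s, exists C : {set V}, [/\ C \subset A, C != finset.set0,
    {in C, s =1 f} & forall i, i \notin C -> s i = i].
Proof.
move=> A0 fA.
have [C /minsetP[/andP[C0 fC] Cmin] CA] :=
  @minset_exists _ (fun B => (B != finset.set0) && (f @: B \subset B)) A
    (introT andP (conj A0 fA)).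
have fCE : f @: C = C.
  apply: Cmin => //; rewrite imsetS// andbT.
  by have [x xC] := set0Pn _ C0; apply/set0Pn; exists (f x); exact: imset_f.
have injC : {in C &, injective f} by apply/imset_injP; rewrite fCE.
pose g i := if i \in C then f i else i.
have gC i : (g i \in C) = (i \in C).
  by rewrite /g; case: ifP => // iC; rewrite -fCE imset_f.
have injg : injective g.
  move=> i j gij; have := gC i; rewrite gij gC => ijC.
  move: gij; rewrite /g ijC; case: ifP => // iC.
  by apply: injC; rewrite // ijC.
exists (perm injg), C; split=> // i iC; rewrite permE /g ?iC//.
by rewrite (negPf iC).
Qed.

(** A circulation is a combination of cycles. As long as some off-diagonal
    entry of m is positive, moving on along positive off-diagonal entries never
    gets stuck, because row and column sums agree. This yields a permutation of
    a nonempty set of vertices along such entries, and the smallest of them, t,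
    can be subtracted. The induction is on the number of positive off-diagonal
    entries. *)
Lemma circulation_ge0 m w : (forall i j, 0 <= m i j) ->
  (forall i, \sum_j m i j = \sum_j m j i) -> (forall i, w i i = 0) ->
  (forall s, 0 <= \sum_i w i (s i)) ->
  0 <= \sum_i \sum_j m i j * w i j.
Proof.
move=> m0 mE w0 ws.
pose supp m := [set e : V * V | (e.1 != e.2) && (0 < m e.1 e.2)].
have [n] := ubnP #|supp m|; elim: n => // n IH in m m0 mE *.
rewrite ltnS => suppn.
(* the vertices with a positive off-diagonal entry in their row *)
pose A := [set i | [exists j, (i != j) && (0 < m i j)]].
have [A0|A0] := eqVneq A finset.set0.
  apply: sumr_ge0 => i _; apply: sumr_ge0 => j _.
  have [->|ij] := eqVneq i j; first by rewrite w0 mulr0.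
  suff /eqP -> : m i j == 0 by rewrite mul0r.
  apply: contraT => mij; have : i \in A.
    by rewrite inE; apply/existsP; exists j; rewrite ij lt_def mij m0.
  by rewrite A0 inE.
pose f i := if [pick j | (i != j) && (0 < m i j)] is Some j then j else i.
have fP i : i \in A -> (i != f i) && (0 < m i (f i)).
  rewrite inE /f => /existsP[j ij]; case: pickP => [//|/(_ j)].
  by rewrite ij.
have fA : f @: A \subset A.
  apply/fintype.subsetP => _ /imsetP[i /fP/andP[ifi mifi] ->].
  rewrite inE; apply: contraT; rewrite negb_exists => /forallP fi0.
  have : \sum_(j | j != f i) m (f i) j = \sum_(j | j != f i) m j (f i).
    apply: (addrI (m (f i) (f i))).
    by rewrite -(bigD1 (f i) (P := xpredT))// -(bigD1 (f i) (P := xpredT)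
      (F := fun j => m j (f i))).
  rewrite big1 => [/esym/eqP|j jfi]; last first.
    by have := fi0 j; rewrite eq_sym jfi/= lt_def m0 andbT negbK => /eqP.
  rewrite psumr_eq0// => /allP /(_ i (mem_index_enum _)).
  by rewrite ifi/= => /eqP mi; move: mifi; rewrite mi ltxx.
have [s [C [CA C0 sC sNC]]] := invariant_set_perm A0 fA.
have [i0 i0C] := set0Pn _ C0.
pose i1 := [arg min_(i < i0 in C) m i (s i)]%O.
have [i1C i1min] : i1 \in C /\ forall i, i \in C -> m i1 (s i1) <= m i (s i).
  by rewrite /i1; case: arg_minP.
set t := m i1 (s i1).
have CP i : i \in C -> (i != s i) && (0 < m i (s i)).
  by move=> iC; rewrite sC//; apply: fP; exact: (fintype.subsetP CA).
have t0 : 0 < t by have /andP[] := CP _ i1C.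
pose d i j : R := ((i \in C) && (j == s i))%:R.
have sCE i : (s i \in C) = (i \in C).
  apply/idP/idP => [siC|iC]; last first.
    apply: contraT => siC; have /perm_inj sii := sNC _ siC.
    by move: siC; rewrite sii iC.
  by apply: contraT => iC; move: (iC); rewrite -(sNC _ iC) siC.
pose m' i j := m i j - t * d i j.
have dsum i : \sum_j d i j = (i \in C)%:R.
  rewrite (bigD1 (s i))//= big1 => [|j /negPf jsi].
    by rewrite /d eqxx andbT addr0.
  by rewrite /d jsi andbF.
have dsum' i : \sum_j d j i = (i \in C)%:R.
  rewrite (bigD1 (s^-1%g i))//= big1 => [|j jsi]; last first.
    rewrite /d; case: eqP => [ij|]; last by rewrite andbF.
    by move: jsi; rewrite ij permK eqxx.
  by rewrite /d permKV eqxx andbT addr0 -sCE permKV.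
have m'0 i j : 0 <= m' i j.
  rewrite /m' /d; case: (boolP (_ && _)) => [/andP[iC /eqP ->]|_].
    by rewrite mulr1 subr_ge0 i1min.
  by rewrite mulr0 subr0.
have dw : \sum_i \sum_j d i j * w i j = \sum_i w i (s i).
  apply: eq_bigr => i _; rewrite (bigD1 (s i))//= big1 => [|j /negPf jsi].
    rewrite /d eqxx andbT addr0; case: (boolP (i \in C)) => [|/sNC ->].
      by rewrite mul1r.
    by rewrite w0 mulr0.
  by rewrite /d jsi andbF mul0r.
rewrite (_ : \sum_i _ = \sum_i \sum_j m' i j * w i j
                        + t * \sum_i \sum_j d i j * w i j); last first.
  rewrite mulr_sumr -big_split; apply: eq_bigr => i _ /=.
  rewrite mulr_sumr -big_split; apply: eq_bigr => j _ /=.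
  by rewrite mulrA -mulrDl subrK.
apply: addr_ge0; last by rewrite dw mulr_ge0// ltW.
apply: IH => //.
  move=> i; rewrite /m' !sumrB -!mulr_sumr dsum dsum' mE//.
apply: leq_trans suppn; apply: proper_card; apply/properP; split.
  apply/fintype.subsetP => -[i j]; rewrite !inE/= => /andP[-> m'ij]/=.
  rewrite (lt_le_trans m'ij)// /m' lerBlDr lerDl mulr_ge0 ?(ltW t0)//.
exists (i1, s i1); rewrite !inE/= ?(CP _ i1C)//.
by rewrite /m' /d i1C eqxx mulr1 subrr ltxx andbF.
Qed.

(** The inequality behind Birkhoff's theorem. After relabelling the columns by
    s, optimality of s says that the reduced costs w have nonnegative sums along
    permutations, and m becomes a circulation. *)
Lemma assignment_le m c (r : R) s : (forall i j, 0 <= m i j) ->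
  (forall i, \sum_j m i j = r) -> (forall j, \sum_i m i j = r) ->
  (forall s', \sum_i c i (s i) <= \sum_i c i (s' i)) ->
  r * \sum_i c i (s i) <= \sum_i \sum_j m i j * c i j.
Proof.
move=> m0 mrow mcol smin.
pose m' i j := m i (s j); pose w i j := c i (s j) - c i (s i).
have reind (F : V -> R) : \sum_j F j = \sum_j F (s j).
  by rewrite (reindex_inj (@perm_inj _ s)).
suff W0 : 0 <= \sum_i \sum_j m' i j * w i j.
  rewrite -subr_ge0 (_ : _ - _ = \sum_i \sum_j m' i j * w i j)//.
  rewrite mulr_sumr -sumrB; apply: eq_bigr => i _.
  rewrite [X in X - _]reind -(mrow i) (reind (m i)) mulr_suml -sumrB.
  by apply: eq_bigr => j _; rewrite mulrBr.
apply: circulation_ge0 => [i j|i|i|s'].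
- exact: m0.
- by rewrite /m' -(reind (m i)) mrow mcol.
- by rewrite /w subrr.
- rewrite sumrB subr_ge0; have := smin (s' * s)%g.
  by under [X in _ <= X -> _]eq_bigr do rewrite permM.
Qed.

End assignment.

Local Open Scope classical_set_scope.

(** * Maps with countably many values *)

Section countable_valued.
Context d (T : measurableType d).

(** For a countable K this is measurability for the discrete sigma-algebra,
    stated without putting that structure on K. *)
Definition measurable_fibers (K : Type) (a : T -> K) :=
  forall k, measurable (a @^-1` [set k]).

Lemma measurable_fibers_preimage (K : countType) (a : T -> K) (S : set K) :
  measurable_fibers a -> measurable (a @^-1` S).
Proof.
move=> ma; rewrite (_ : _ @^-1` _ = \bigcup_k a @^-1` (S `&` [set k])).
  apply: countable_bigcupT_measurable; first exact: countableP.
  move=> k; have [kS|kS] := pselect (S k).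
    by rewrite setI1 mem_set.
  by rewrite setI1 memNset// preimage_set0.
by apply/seteqP; split => [x Sx|x [k _ []//]]; exists (a x).
Qed.

Lemma measurable_fibers_pair (K L : Type) (a : T -> K) (b : T -> L) :
  measurable_fibers a -> measurable_fibers b ->
  measurable_fibers (fun x => (a x, b x)).
Proof.
move=> ma mb [k l].
rewrite (_ : _ @^-1` _ = a @^-1` [set k] `&` b @^-1` [set l]).
  exact: measurableI.
by apply/seteqP; split => [x [<- <-]|x [/= -> ->]].
Qed.

Lemma measurable_fun_fibers d' (T' : measurableType d') (K : countType)
    (a : T -> K) (g : K -> T') :
  measurable_fibers a -> measurable_fun setT (fun x => g (a x)).
Proof.
move=> ma _ A mA; rewrite setTI.
exact: (measurable_fibers_preimage (g @^-1` A)).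
Qed.

(** The value at z is the first k, in an enumeration of K, with z in M k. *)
Lemma measurable_choice (K : countType) (k0 : K) (M : K -> set T) :
  (forall k, measurable (M k)) ->
  exists p : T -> K, measurable_fibers p /\
    forall z, (exists k, M k z) -> M (p z) z.
Proof.
move=> mM.
pose m n := if unpickle n is Some k then M k else set0.
have mm n : measurable (m n) by rewrite /m; case: unpickle.
pose S := seqDU m.
have mS n : measurable (S n).
  by apply: measurableD => //; exact: bigsetU_measurable.
have S1 z : is_subset1 [set n | S n z].
  by move=> i j /= Si Sj; apply: (@trivIset_seqDU _ m i j) => //; exists z.
pose nu z := xget 0%N [set n | S n z].
have mnu : measurable_fibers nu.
  move=> n; have [->|n0] := eqVneq n 0%N; last first.
    rewrite (_ : _ @^-1` _ = S n)//; apply/seteqP; split => z /=; last first.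
      by move=> Snz; apply: xget_subset1 => //; exact: S1.
    rewrite /nu; case: xgetP => [k -> Skz <-//|_ n0'].
    by rewrite n0' eqxx in n0.
  rewrite (_ : _ @^-1` _ = S 0%N `|` ~` \bigcup_n S n).
    apply: measurableU => //; apply: measurableC; exact: bigcupT_measurable.
  apply/seteqP; split => z /=.
    rewrite /nu; case: xgetP => [k -> Skz <-|nS _]; first by left.
    by right => -[k _ Sk]; exact: nS Sk.
  move=> [S0|nS]; first by apply: xget_subset1 => //; exact: S1.
  by apply: xgetPN => k Sk; apply: nS; exists k.
pose g n := odflt k0 (unpickle n).
exists (fun z => g (nu z)); split.
  by move=> k; exact: (measurable_fibers_preimage (g @^-1` [set k]) mnu).
move=> z [k Mkz].
have [n _ Sn] : (\bigcup_n S n) z.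
  by rewrite -seqDU_bigcup_eq; exists (pickle k) => //; rewrite /m pickleK.
have : m (nu z) z.
  by apply: subset_seqDU; apply: (@xgetI _ 0%N [set n | S n z] n).
by rewrite /g /m; case: unpickle.
Qed.

End countable_valued.

(** * Cells that shrink to points *)

Lemma borel_preimage (Z1 Z2 : ptopologicalType) (f : Z1 -> Z2) (A : set Z2) :
  continuous f -> borel A -> borel (f @^-1` A).
Proof.
move=> cf bA; rewrite -[X in borel X]setTI.
exact: (continuous_borel_measurable cf measurableT bA).
Qed.

Lemma borel_fst (Z1 Z2 : ptopologicalType) (A : set Z1) :
  borel A -> borel (fst @^-1` A : set (Z1 * Z2)%type).
Proof. by apply: borel_preimage => z; exact: cvg_fst. Qed.

Lemma borel_snd (Z1 Z2 : ptopologicalType) (A : set Z2) :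
  borel A -> borel (snd @^-1` A : set (Z1 * Z2)%type).
Proof. by apply: borel_preimage => z; exact: cvg_snd. Qed.

(** The fibers of q n partition Z; the condition makes these partitions a
    substitute for a countable base of the topology. *)
Definition cells_shrink (Z : topologicalType) (K : Type) (q : nat -> Z -> K) :=
  forall x V, nbhs x V -> \forall n \near \oo, forall y, q n y = q n x -> V y.

(** The sets that contain almost all the cells around X form a filter, and
    convergence to X in the product topology is tested coordinatewise. *)
Lemma cells_shrink_ptws (Z : topologicalType) (K : Type) (q : nat -> Z -> K)
    (N : nat) : cells_shrink q ->
  cells_shrink (fun n (X : {ptws 'I_N -> Z}) => [ffun i => q n (X i)]).
Proof.
move=> sq X.
pose cell n (Y : {ptws 'I_N -> Z}) := [ffun i => q n (Y i)].
pose B : set_system {ptws 'I_N -> Z} :=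
  [set V | \forall n \near \oo, forall Y, cell n Y = cell n X -> V Y].
have fB : Filter B.
  split; first exact: nearW.
    move=> V W; rewrite /B /= => BV BW.
    by apply: filterS2 BV BW => n cV cW Y YX; split; [exact: cV|exact: cW].
  move=> V W VW; rewrite /B /=; apply: filterS => n cV Y YX; exact/VW/cV.
suff : B --> X by move=> BX V /BX.
apply/cvg_sup => i V /=.
rewrite (@nbhsE (initial_topology (@^~ i))) => -[_ [[W oW <-] WX] WV].
have /sq XW : nbhs (X i) W by exact: open_nbhs_nbhs.
rewrite nbhs_simpl /B /=; apply: filterS XW => n XW Y /ffunP /(_ i).
by rewrite !ffunE => /XW YW; exact: WV.
Qed.

(** An open set is the union of the countably many products of cells that it
    contains. *)
Lemma borel_prod_measurable (Z1 Z2 : ptopologicalType) (K L : countType)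
    (q1 : nat -> Z1 -> K) (q2 : nat -> Z2 -> L) :
  (forall n, @measurable_fibers _ (borelType Z1) _ (q1 n)) ->
  (forall n, @measurable_fibers _ (borelType Z2) _ (q2 n)) ->
  cells_shrink q1 -> cells_shrink q2 ->
  measurable_fun [set: (borelType Z1 * borelType Z2)%type]
    (id : borelType Z1 * borelType Z2 -> borelType (Z1 * Z2)%type).
Proof.
move=> mq1 mq2 sq1 sq2.
apply: (@measurability _ _ _ (borelType (Z1 * Z2)%type) _ _
  (@open (Z1 * Z2)%type)) => //.
move=> _ [U oU <-]; rewrite setTI preimage_id.
pose cell (t : nat * (K * L)) :=
  (q1 t.1 @^-1` [set t.2.1] `*` q2 t.1 @^-1` [set t.2.2])
  : set (borelType Z1 * borelType Z2)%type.
pose cellU t := if `[< cell t `<=` U >] then cell t else set0.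
have -> : U = \bigcup_t cellU t.
  apply/seteqP; split => [[x y] Uxy|z [t _]]; last first.
    by rewrite /cellU; case: asboolP => // tU /tU.
  have [[V W] /= [xV yW] VWU] : nbhs (x, y) U by exact: open_nbhs_nbhs.
  have [n [Vn Wn]] : exists n, (forall x', q1 n x' = q1 n x -> V x') /\
      forall y', q2 n y' = q2 n y -> W y'.
    have := filterI (sq1 _ _ xV) (sq2 _ _ yW) => /(_ eventually_filter).
    by move=> /filter_ex[n [Vn Wn]]; exists n.
  exists (n, (q1 n x, q2 n y)) => //; rewrite /cellU asboolT//.
  by move=> -[x' y'] [/= /Vn x'V /Wn y'W]; exact: VWU.
apply: countable_bigcupT_measurable; first exact: countableP.
move=> [n [k l]]; rewrite /cellU; case: ifP => // _.
by apply: measurableX; [exact: mq1|exact: mq2].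
Qed.

(** * Sets whose indicator is a limit of continuous functions *)

(** The measure of such a set is a limit of integrals of bounded continuous
    functions, so that it depends on the measure in a Borel way for the weak
    topology. The uniform bound makes the convergence dominated. *)
Definition continuous_limit (R : realType) (Z : topologicalType) (B : set Z) :=
  exists f : nat -> Z -> R, [/\ forall n, continuous (f n),
    forall n z, `|f n z| <= 1 & forall z, f n z @[n --> \oo] --> (\1_B z : R)].

Section continuous_limit.
Variable (R : realType).

Lemma continuous_limitI (Z : topologicalType) (A B : set Z) :
  continuous_limit R A -> continuous_limit R B -> continuous_limit R (A `&` B).
Proof.
move=> [f [cf f1 fA]] [g [cg g1 gB]]; exists (fun n z => f n z * g n z); split.
- by move=> n z; apply: cvgM; [exact: cf|exact: cg].
- by move=> n z; rewrite normrM mulr_ile1.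
- by move=> z; rewrite indicI; apply: cvgM; [exact: fA|exact: gB].
Qed.

Lemma continuous_limit_forall (Z : topologicalType) (I : finType)
    (B : I -> set Z) : (forall i, continuous_limit R (B i)) ->
  continuous_limit R [set z | forall i, B i z].
Proof.
move=> cB.
have cs (s : seq I) : continuous_limit R [set z | forall i, i \in s -> B i z].
  elim: s => [|i s IH].
    exists (fun _ _ => 1); split.
    - by move=> _ z; exact: cvg_cst.
    - by move=> _ z; rewrite normr1.
    - by move=> z; rewrite indicE mem_set//; exact: cvg_cst.
  rewrite (_ : [set _ | _] = B i `&` [set z | forall i, i \in s -> B i z]).
    exact: continuous_limitI.
  apply/seteqP; split => z.
    move=> zs; split; first by apply: zs; rewrite mem_head.
    by move=> j js; apply: zs; rewrite inE js orbT.
  by move=> [zi zs] j; rewrite inE => /predU1P[->//|/zs].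
rewrite (_ : [set _ | _] = [set z | forall i, i \in enum I -> B i z])//.
apply/seteqP; split => z zB i; first by move=> _; exact: zB.
by apply: zB; rewrite mem_enum.
Qed.

Lemma continuous_minr (T : topologicalType) (f g : T -> R) :
  continuous f -> continuous g -> continuous (fun x => Num.min (f x) (g x)).
Proof. by move=> cf cg x; exact: (@continuous_min R T f g x (cf x) (cg x)). Qed.

Lemma continuous_maxr (T : topologicalType) (f g : T -> R) :
  continuous f -> continuous g -> continuous (fun x => Num.max (f x) (g x)).
Proof. by move=> cf cg x; exact: (@continuous_max R T f g x (cf x) (cg x)). Qed.

(** Decreases, as n grows, to the indicator of the half line [0, +oo[. *)
Let ramp (n : nat) (s : R) := Num.min 1 (Num.max 0 (1 + n%:R * s)).

Let ramp_continuous n : continuous (ramp n).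
Proof.
apply: continuous_minr; first by move=> s; exact: cvg_cst.
apply: continuous_maxr; first by move=> s; exact: cvg_cst.
move=> s; apply: cvgD; first exact: cvg_cst.
by apply: cvgM; [exact: cvg_cst|exact: cvg_id].
Qed.

Let ramp01 n s : 0 <= ramp n s <= 1.
Proof. by rewrite /ramp le_min ler01 le_max lexx/= ge_min lexx. Qed.

Let le_ramp n s t : s <= t -> ramp n s <= ramp n t.
Proof.
move=> st; rewrite /ramp; apply: le_min2 => //; apply: le_max2 => //.
by rewrite lerD2l ler_wpM2l.
Qed.

Let ramp_cvg s : ramp n s @[n --> \oo] --> ((0 <= s)%R%:R : R).
Proof.
have [s0|s0] := leP 0 s.
  rewrite (_ : (fun n => ramp n s) = cst 1); first exact: cvg_cst.
  apply/funext => n; rewrite /ramp max_r ?min_l//; last first.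
    by rewrite addr_ge0// mulr_ge0.
  by rewrite lerDl mulr_ge0.
apply: cvg_near_cst; near=> n.
rewrite /ramp max_l ?min_r//.
have : (- s)^-1 <= n%:R by near: n; exact: nbhs_infty_ger.
rewrite -[_^-1]div1r ler_pdivrMr ?oppr_gt0// mulrN; lra.
Unshelve. all: by end_near. Qed.

(** The indicator of [0, 1[ is the difference of the indicators of [0, +oo[ and
    of [1, +oo[, both limits of ramps. *)
Lemma continuous_limit_unit_interval (Z : topologicalType) (g : Z -> R) :
  continuous g -> continuous_limit R [set z | 0 <= g z < 1].
Proof.
move=> cg; exists (fun n z => ramp n (g z) - ramp n (g z - 1)); split.
- move=> n z; apply: cvgB.
    apply: (@continuous_comp _ _ _ g (ramp n)); first exact: cg.
    exact: ramp_continuous.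
  apply: (@continuous_comp _ _ _ (fun z => g z - 1) (ramp n)); last first.
    exact: ramp_continuous.
  by apply: cvgB; [exact: cg|exact: cvg_cst].
- move=> n z; have := ramp01 n (g z); have := ramp01 n (g z - 1).
  have : ramp n (g z - 1) <= ramp n (g z) by apply: le_ramp; rewrite gerBl.
  move=> h /andP[? ?] /andP[? ?]; rewrite ger0_norm ?subr_ge0//; lra.
- move=> z; rewrite (_ : \1_ _ z = (0 <= g z)%R%:R - (0 <= g z - 1)%R%:R :> R).
    by apply: cvgB; exact: ramp_cvg.
  rewrite indicE subr_ge0; have [gz|gz] := boolP (0 <= g z < 1).
    by rewrite mem_set//; move: gz => /andP[-> gz1]; rewrite leNgt gz1 subr0.
  rewrite memNset; last exact/negP.
  move: gz; rewrite negb_and -leNgt -ltNge => /orP[gz|gz].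
    by rewrite !leNgt gz (lt_trans gz)// subrr.
  by rewrite gz (le_trans _ gz) ?ler01// subrr.
Qed.

Lemma continuous_limit_borel (Z : ptopologicalType) (B : set Z) :
  continuous_limit R B -> borel B.
Proof.
move=> [f [cf f1 fB]].
have mB : measurable_fun [set: borelType Z] (\1_B : borelType Z -> R).
  apply: measurable_fun_cvg (fun n => continuous_borel_measurableR (cf n)) _.
  by move=> z _; exact: fB.
have := mB measurableT [set 1] (measurable_set1 _).
rewrite setTI (_ : _ @^-1` _ = B)//; apply/seteqP; split => z /=.
  rewrite indicE; case: (boolP (z \in B)) => [/set_mem//|_ /esym/eqP].
  by rewrite oner_eq0.
by move=> Bz; rewrite indicE mem_set.
Qed.

Lemma measurable_eval_continuous_limit (Z : ptopologicalType) (B : set Z) :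
  continuous_limit R B ->
  measurable_fun [set: borelType (Prob R Z)]
    (fun mu : Prob R Z => (mu : probability (borelType Z) R) B).
Proof.
move=> cB; have bB := continuous_limit_borel cB; move: cB => [f [cf f1 fB]].
have bf n : continuous (f n) /\ exists M : R, forall z, `|f n z| <= M.
  by split; [exact: cf|exists 1].
pose fb n : bounded_continuous R Z := exist _ (f n) (bf n).
have mf n : measurable_fun [set: borelType (Prob R Z)]
    (fun mu : Prob R Z => (Prob_test mu (fb n))%:E).
  apply/measurable_EFinP.
  apply: continuous_borel_measurableR.
  have c1 : continuous
      (@Prob_test R Z : Prob R Z -> {ptws bounded_continuous R Z -> R}).
    exact: initial_continuous.
  have c2 : continuous
      (fun h : {ptws bounded_continuous R Z -> R} => h (fb n)).
    move=> h; have /cvg_sup/(_ (fb n)) hh : nbhs h --> h by [].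
    apply: cvg_trans (@initial_continuous _ _ (@^~ (fb n)) h).
    exact: cvg_app.
  by move=> mu; exact: (continuous_comp (c1 mu) (c2 (Prob_test mu))).
apply: emeasurable_fun_cvg mf _ => mu _.
pose P : probability (borelType Z) R := mu.
have := @dominated_convergence _ (borelType Z) R P setT measurableT
  (fun n z => (f n z)%:E) (fun z => (\1_B z)%:E) (cst 1%E).
case.
- move=> n; apply/measurable_EFinP; exact: continuous_borel_measurableR.
- by apply/measurable_EFinP; exact: measurable_indic.
- by apply: aeW => z _; apply/fine_cvgP; split; [exact: nearW|exact: fB].
- exact: (finite_measure_integrable_cst P 1 measurableT).
- by apply: aeW => z n _; rewrite lee_fin.
move=> _ _; rewrite integral_indic// setIT.
set u := (X in X @ \oo --> _); set v := (X in _ -> X @ \oo --> _).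
suff -> : u = v by [].
apply/funext => n; rewrite /u /v /Prob_test /Rintegral/= fineK//.
apply: (@integrable_fin_num _ (borelType Z) R P) => //.
apply: (@le_integrable _ (borelType Z) R P setT measurableT _ (cst 1%E)).
- by apply/measurable_EFinP; exact: continuous_borel_measurableR.
- by move=> z _; rewrite lee_fin normr1.
- exact: (finite_measure_integrable_cst P 1 measurableT).
Qed.

End continuous_limit.

(** * Cubic cells of a subset of Euclidean space *)

Lemma continuous_sqr (R : realType) (T : topologicalType) (f : T -> R) :
  continuous f -> continuous (fun x => f x ^+ 2).
Proof. by move=> cf x; apply: cvgM; exact: cf. Qed.

Lemma continuous_affine (R : realType) (T : topologicalType) (f : T -> R)
    (a b : R) : continuous f -> continuous (fun x => a * f x - b).
Proof.
move=> cf x; apply: cvgB; last exact: cvg_cst.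
by apply: cvgM; [exact: cvg_cst|exact: cf].
Qed.

Section euclidean.
Variables (R : realType) (d : nat).
Implicit Types u v : 'rV[R]_d.

Let sq u := \sum_(k < d) u 0 k ^+ 2.

Let sq_ge0 u : 0 <= sq u. Proof. by apply: sumr_ge0 => k _; exact: sqr_ge0. Qed.

Let sqE u : euclidean_norm u ^+ 2 = sq u.
Proof. by rewrite sqr_sqrtr//; exact: sq_ge0. Qed.

Lemma euclidean_norm_ge0 u : 0 <= euclidean_norm u.
Proof. exact: sqrtr_ge0. Qed.

Lemma euclidean_normN u : euclidean_norm (- u) = euclidean_norm u.
Proof.
by congr Num.sqrt; apply: eq_bigr => k _; rewrite mxE sqrrN.
Qed.

(** Cauchy-Schwarz: with a and b the norms of u and v, expand the sum of the
    squares (b u_k - a v_k)^2; when a b = 0 one of the vectors vanishes. *)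
Lemma euclidean_dot_le u v :
  \sum_(k < d) u 0 k * v 0 k <= euclidean_norm u * euclidean_norm v.
Proof.
set a := euclidean_norm u; set b := euclidean_norm v.
have a0 : 0 <= a by exact: euclidean_norm_ge0.
have b0 : 0 <= b by exact: euclidean_norm_ge0.
have : 0 <= \sum_(k < d) (b * u 0 k - a * v 0 k) ^+ 2.
  by apply: sumr_ge0 => k _; exact: sqr_ge0.
rewrite (eq_bigr (fun k => b ^+ 2 * u 0 k ^+ 2 + (a ^+ 2 * v 0 k ^+ 2 -
  2 * (a * b) * (u 0 k * v 0 k)))); last by move=> k _; ring.
rewrite big_split/= sumrB -!mulr_sumr -/(sq u) -/(sq v) -!sqE -/a -/b => S0.
have : 0 <= a * b * (a * b - \sum_(k < d) u 0 k * v 0 k) by lra.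
have [ab0|] := eqVneq (a * b) 0; last first.
  move=> abn0; rewrite pmulr_rge0 ?subr_ge0//.
  by rewrite lt_def abn0 mulr_ge0.
move=> _; rewrite ab0 big1// => k _.
have z0 (w : 'rV[R]_d) : euclidean_norm w = 0 -> w 0 k = 0.
  move=> w0; have /eqP := sqE w; rewrite w0 expr0n/= eq_sym.
  rewrite psumr_eq0 => [/allP/(_ k (mem_index_enum _))|i _]; last first.
    exact: sqr_ge0.
  by rewrite sqrf_eq0 => /eqP.
move/eqP: ab0; rewrite mulf_eq0 => /orP[/eqP/z0 ->|/eqP/z0 ->].
  by rewrite mul0r.
by rewrite mulr0.
Qed.

Lemma euclidean_normD u v :
  euclidean_norm (u + v) <= euclidean_norm u + euclidean_norm v.
Proof.
rewrite -ler_sqr ?nnegrE ?addr_ge0 ?euclidean_norm_ge0//.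
rewrite sqE /sq sqrrD !sqE mulr2n.
rewrite (eq_bigr
  (fun k => u 0 k ^+ 2 + (2 * (u 0 k * v 0 k) + v 0 k ^+ 2))); last first.
  by move=> k _; rewrite mxE; ring.
rewrite !big_split/= -mulr_sumr -/(sq u) -/(sq v).
have := euclidean_dot_le u v; lra.
Qed.

Lemma euclidean_norm_le u (e : R) : 0 <= e -> (forall k, `|u 0 k| <= e) ->
  euclidean_norm u <= Num.sqrt d%:R * e.
Proof.
move=> e0 ue; rewrite -(ger0_norm e0) -sqrtr_sqr -sqrtrM//.
apply: ler_wsqrtr; rewrite -[X in X%:R * _](card_ord d) mulr_natl -sumr_const.
apply: ler_sum => k _; rewrite -[leLHS]real_normK ?num_real//.
by rewrite ler_sqr ?nnegrE.
Qed.

Lemma euclidean_norm_continuous : continuous (@euclidean_norm R d).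
Proof.
move=> u; apply: (@continuous_comp _ _ _ sq Num.sqrt).
  move: u; apply: (continuous_big (@add_continuous R)) => k _.
  by apply: continuous_sqr => v; exact: coord_continuous.
exact: sqrt_continuous.
Qed.

End euclidean.

Section cells.
Variables (R : realType) (d : nat) (E : set 'rV[R]_d) (E0 : E !=set0).
Local Notation Et := (nonempty_subset E0).

Lemma nonempty_subset_val_continuous : continuous (set_val : Et -> 'rV[R]_d).
Proof. exact: initial_continuous. Qed.

Lemma truncated_dist_ge0 (x y : Et) : 0 <= truncated_dist x y.
Proof. by rewrite /truncated_dist le_min euclidean_norm_ge0 ler01. Qed.

Lemma truncated_dist_continuous :
  continuous (fun z : (Et * Et)%type => truncated_dist z.1 z.2).
Proof.
apply: continuous_minr; last by move=> z; exact: cvg_cst.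
move=> z.
apply: (@continuous_comp _ _ _
  (fun z : (Et * Et)%type => set_val z.1 - set_val z.2)
  (@euclidean_norm R d)); last exact: euclidean_norm_continuous.
apply: cvgB.
  apply: (@continuous_comp _ _ _ fst set_val); first exact: cvg_fst.
  exact: nonempty_subset_val_continuous.
apply: (@continuous_comp _ _ _ snd set_val); first exact: cvg_snd.
exact: nonempty_subset_val_continuous.
Qed.

(** The label of the cube of side 1 / (n + 1) that contains x. *)
Definition cell (n : nat) (x : Et) : {ffun 'I_d -> int} :=
  [ffun k => Num.floor (n.+1%:R * (set_val x) 0 k)].

Lemma cell_eq n (x : Et) t : cell n x = t <->
  forall k, 0 <= n.+1%:R * (set_val x) 0 k - (t k)%:~R < 1.
Proof.
split=> [<- k|xt].
  rewrite ffunE subr_ge0 ltrBlDl.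
  have := real_floor_itv (num_real (n.+1%:R * set_val x 0 k)).
  by rewrite rmorphD.
apply/ffunP => k; rewrite ffunE; apply: floor_def.
by have := xt k; rewrite subr_ge0 ltrBlDl rmorphD.
Qed.

(** A cube is an intersection of d slabs, each given by a half-open interval. *)
Lemma continuous_limit_cell n t : continuous_limit R (cell n @^-1` [set t]).
Proof.
have -> : cell n @^-1` [set t] = [set x : Et | forall k : 'I_d,
    0 <= n.+1%:R * (set_val x) 0 k - (t k)%:~R < 1].
  by apply/seteqP; split => x /cell_eq.
apply: continuous_limit_forall => k; apply: continuous_limit_unit_interval.
apply: (@continuous_affine R Et (fun x => set_val x 0 k)) => x.
apply: (@continuous_comp _ _ _ set_val (fun u : 'rV[R]_d => u 0 k)).
  exact: nonempty_subset_val_continuous.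
exact: coord_continuous.
Qed.

Lemma cell_coord_le n (x y : Et) k : cell n x = cell n y ->
  `|(set_val x - set_val y) 0 k| <= n.+1%:R^-1.
Proof.
move=> xy; have /cell_eq/(_ k) := xy; have /cell_eq/(_ k) := erefl (cell n y).
rewrite -[_^-1]div1r ler_pdivlMr// !mxE -[X in _ * X <= _]normr_nat -normrM.
rewrite ler_norml mulrBl ![_ * n.+1%:R]mulrC.
by move=> /andP[? ?] /andP[? ?]; apply/andP; split; lra.
Qed.

Lemma cell_shrink : cells_shrink cell.
Proof.
move=> x V; rewrite (@nbhsE (initial_topology (set_val : Et -> 'rV[R]_d))).
move=> -[_ [[W oW <-] Wx] WV].
have /nbhs_ballP[e /= e0 eW] : nbhs (set_val x) W by exact: open_nbhs_nbhs.
near=> n; move=> y xy; apply: WV; apply: eW.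
split=> // i k; rewrite ord1 /ball /=.
have := cell_coord_le k xy; rewrite distrC !mxE => /le_lt_trans; apply.
rewrite invf_plt ?posrE// -natr1 ltr_pwDr//.
by near: n; exact: nbhs_infty_ger.
Unshelve. all: by end_near. Qed.

Lemma truncated_dist_triangle (x y x' y' : Et) : truncated_dist x y <=
  truncated_dist x' y' + (euclidean_norm (set_val x - set_val x')
                         + euclidean_norm (set_val y - set_val y')).
Proof.
have h : euclidean_norm (set_val x - set_val y) <=
    euclidean_norm (set_val x' - set_val y') +
    (euclidean_norm (set_val x - set_val x')
                         + euclidean_norm (set_val y - set_val y')).
  rewrite -(euclidean_normN (set_val y - _)) opprB.
  rewrite (_ : set_val x - set_val y = (set_val x' - set_val y') +
    ((set_val x - set_val x') + (set_val y' - set_val y))); last first.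
    by apply/rowP => k; rewrite !mxE; ring.
  apply: le_trans (euclidean_normD _ _) _; rewrite lerD2l.
  exact: euclidean_normD.
have p := euclidean_norm_ge0 (set_val x - set_val x').
have p' := euclidean_norm_ge0 (set_val y - set_val y').
rewrite /truncated_dist ge_min addr_minl le_min.
case: (leP (euclidean_norm (set_val x' - set_val y')) 1) => h1.
  by rewrite h /=; case: leP => // h2; lra.
by apply/orP; right; rewrite le_min; apply/andP; split; lra.
Qed.

Lemma cell_oscillation (e : R) : 0 < e -> exists n, forall x y x' y' : Et,
  cell n x = cell n x' -> cell n y = cell n y' ->
  truncated_dist x y <= truncated_dist x' y' + e.
Proof.
move=> e0; pose s : R := Num.sqrt d%:R.
have s0 : 0 <= s by exact: sqrtr_ge0.
pose n := Num.trunc (2 * s / e).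
have en : 2 * (s * n.+1%:R^-1) <= e.
  rewrite mulrA ler_pdivrMr// [leRHS]mulrC -ler_pdivrMr//.
  exact/ltW/real_truncnS_gt/num_real.
have close (x x' : Et) : cell n x = cell n x' ->
    euclidean_norm (set_val x - set_val x') <= s * n.+1%:R^-1.
  by move=> xx'; apply: euclidean_norm_le => // k; exact: cell_coord_le.
exists n => x y x' y' /close xx' /close yy'.
apply: le_trans (truncated_dist_triangle x y x' y') _; rewrite lerD2l.
by apply: le_trans en; rewrite mulr_natl mulr2n lerD.
Qed.

End cells.

Local Open Scope ereal_scope.

(** * Integrals and sums *)

(** Without measurability: a simple function below f is below g. *)
Lemma le_lower_integral d (T : measurableType d) (R : realType)
    (mu : {measure set T -> \bar R}) (f g : T -> \bar R) :
  (forall x, 0 <= f x) -> (forall x, f x <= g x) ->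
  \int[mu]_x f x <= \int[mu]_x g x.
Proof.
move=> f0 fg; rewrite !ge0_integralTE//; last first.
  by move=> x; exact: le_trans (fg x).
apply: ge_ereal_sup => _ [h /= hf <-]; apply: ereal_sup_ubound; exists h => //=.
by move=> x; exact: le_trans (fg x).
Qed.

Import HBNNSimple.

(** Composition with phi turns simple functions below f into simple functions
    below f o phi. Only an inequality results for a nonmeasurable f, since a
    simple function below f o phi need not factor through phi. *)
Lemma lower_integral_pushforward d1 d2 (T1 : measurableType d1)
    (T2 : measurableType d2) (R : realType) (mu : {measure set T1 -> \bar R})
    (nu : {measure set T2 -> \bar R}) (phi : T1 -> T2) (f : T2 -> \bar R) :
  measurable_fun setT phi ->
  (forall A, measurable A -> nu A = mu (phi @^-1` A)) ->
  (forall y, 0 <= f y) -> \int[nu]_y f y <= \int[mu]_x f (phi x).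
Proof.
move=> mphi nuE f0; rewrite [leLHS]ge0_integralTE//.
apply: ge_ereal_sup => _ [h /= hf <-].
rewrite -integralT_nnsfun.
rewrite (eq_measure_integral (pushforward mu phi)); last first.
  by move=> A mA _; rewrite nuE.
rewrite ge0_integral_pushforward//; last 2 first.
  by apply/measurable_EFinP.
  by move=> y _; rewrite lee_fin.
by rewrite preimage_setT; apply: le_lower_integral => x //=; rewrite lee_fin.
Qed.

Lemma integral_addr_cst d (T : measurableType d) (R : realType)
    (P : probability T R) (e : R) (f : T -> \bar R) : (0 <= e)%R ->
  measurable_fun setT f -> (forall z, 0 <= f z) ->
  \int[P]_z (f z + e%:E) = \int[P]_z f z + e%:E.
Proof.
move=> e0 mf f0; rewrite ge0_integralD//.
rewrite integral_cst// [X in _ * X](_ : _ = 1) ?mule1//.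
exact: (probability_setT P).
Qed.

Section esum_scale.
Variables (R : realType) (T : choiceType).

Lemma esumZl (c : R) (a : T -> \bar R) (I : set T) : (0 <= c)%R ->
  (forall i, 0 <= a i) ->
  \esum_(i in I) (c%:E * a i) = c%:E * \esum_(i in I) a i.
Proof.
have le (x : R) (b : T -> \bar R) : (0 <= x)%R -> (forall i, 0 <= b i) ->
    \esum_(i in I) (x%:E * b i) <= x%:E * \esum_(i in I) b i.
  move=> x0 b0; apply: ge_ereal_sup => _ [X [finX XI]] <-.
  rewrite -ge0_mule_fsumr//; apply: lee_wpmul2l; first by rewrite lee_fin.
  by apply: esum_ge; exists X.
rewrite le_eqVlt => /predU1P[<- a0|c0 a0].
  by rewrite mul0e esum1// => i _; rewrite mul0e.
apply/eqP; rewrite eq_le; apply/andP; split; first exact: (le _ _ (ltW c0)).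
have cK (y : \bar R) : c^-1%:E * (c%:E * y) = y.
  by rewrite muleA -EFinM mulVf ?mul1e// gt_eqF.
have cV0 : (0 <= c^-1)%R by rewrite invr_ge0 ltW.
have ca0 i : 0 <= c%:E * a i by rewrite mule_ge0// lee_fin ltW.
have := le _ _ cV0 ca0; rewrite (eq_esum (b := a)) => [|i _]; last exact: cK.
move=> aV; have c0' : 0 <= c%:E by rewrite lee_fin ltW.
apply: le_trans (lee_wpmul2l c0' aV) _.
by rewrite muleA -EFinM mulfV ?gt_eqF// mul1e.
Qed.

End esum_scale.

Section integral_countable_valued.
Context d (T : measurableType d) (R : realType).
Variable mu : {measure set T -> \bar R}.

Lemma integral_fibers (K : countType)
    (a : T -> K) (g : K -> \bar R) (D : set T) :
  measurable_fibers a -> measurable D -> (forall k, 0 <= g k) ->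
  \int[mu]_(x in D) g (a x) =
  \esum_(k in setT) g k * mu (D `&` a @^-1` [set k]).
Proof.
move=> ma mD g0.
pose F n := D `&` (pickle \o a) @^-1` [set n].
have DE : D = \bigcup_n F n.
  by apply/seteqP; split => [x Dx|x [n _ []//]]; exists (pickle (a x)).
have mF n : measurable (F n).
  apply: measurableI => //.
  exact: (measurable_fibers_preimage (pickle @^-1` [set n]) ma).
rewrite {1}DE ge0_integral_bigcup//; last 2 first.
- by apply: measurable_funTS; exact: measurable_fun_fibers.
- apply/trivIsetP => i j _ _ ij; apply/seteqP; split => //.
  by move=> x [[_ /= xi] [_ /= xj]]; move: ij; rewrite -xi -xj eqxx.
rewrite nneseries_esumT => [|n]; last exact: integral_ge0.
rewrite (esumID (range (@pickle K))) => [|n _]; last exact: integral_ge0.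
rewrite !setTI [X in _ + X]esum1 ?adde0; last first.
  move=> n nK; rewrite (_ : F n = set0) ?integral_set0//.
  by apply/seteqP; split => // x [_ /= xn]; apply: nK; exists (a x).
rewrite esum_image; last by move=> k l _ _; exact: (pcan_inj pickleK).
apply: eq_esum => k _.
have FE : F (pickle k) = D `&` a @^-1` [set k].
  by apply/seteqP; split=> x [Dx /= h]; split => //=;
    [exact: (pcan_inj pickleK h)|rewrite h].
rewrite (eq_integral (cst (g k))) ?integral_cst// -?FE// => x.
by rewrite inE FE => -[_ /= ->].
Qed.

Lemma measure_fibers (K : countType)
    (a : T -> K) (D : set T) :
  measurable_fibers a -> measurable D ->
  mu D = \esum_(k in setT) mu (D `&` a @^-1` [set k]).
Proof.
move=> ma mD; rewrite -[LHS]mul1e -integral_cst//.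
rewrite (integral_fibers (g := cst 1) ma)//.
by apply: eq_esum => k _; rewrite mul1e.
Qed.

Lemma integral_sum_indic (I : finType) (a : I -> R) (S : I -> set T) :
  (forall i, (0 <= a i)%R) -> (forall i, measurable (S i)) ->
  \int[mu]_z (\sum_i a i * \1_(S i) z)%:E = \sum_i (a i)%:E * mu (S i).
Proof.
move=> a0 mS.
under eq_integral => z _.
  rewrite -sumEFin; under eq_bigr do rewrite EFinM; over.
rewrite ge0_integral_sum//; last 2 first.
- move=> i; apply/measurable_EFinP; apply: measurable_funM => //.
- by move=> i z _; rewrite lee_fin mulr_ge0.
apply: eq_bigr => i _; rewrite ge0_integralZl//; last 2 first.
- by apply/measurable_EFinP; exact: measurable_indic.
- by rewrite lee_fin.
by rewrite integral_indic// setIT.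
Qed.

(** Every point z lies in as many of the sets A t as of the sets B t, since
    t |-> t * s is a bijection, even though s varies with z. *)
Lemma sum_measure_perm (V : finType) (A B : {perm V} -> set T) :
  (forall t, measurable (A t)) -> (forall t, measurable (B t)) ->
  (forall z, exists s : {perm V}, forall t, A t z <-> B (t * s)%g z) ->
  \sum_t mu (A t) = \sum_t mu (B t).
Proof.
move=> mA mB AB.
rewrite (eq_bigr (fun t => 1%:E * mu (A t))) => [|t _]; last by rewrite mul1e.
rewrite [RHS](eq_bigr (fun t => 1%:E * mu (B t))) => [|t _]; last first.
  by rewrite mul1e.
rewrite -!integral_sum_indic//; apply: eq_integral => z _; congr EFin.
have [s sAB] := AB z; rewrite [RHS](reindex_inj (mulIg s)).
apply: eq_bigr => t _.
by congr (_ * _)%R; rewrite !indicE; congr (_%:R); congr nat_of_bool;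
  apply: asbool_equiv_eq; exact: sAB.
Qed.

End integral_countable_valued.

(** * Gluing along countable labels *)

Section density.
Context d (T : measurableType d) (R : realType).
Variables (mu : {measure set T -> \bar R}) (f : T -> \bar R).
Variables (mf : measurable_fun setT f) (f0 : forall x, 0 <= f x).
Variable f1 : \int[mu]_x f x = 1.

(** The proofs are arguments so that the measure structure below can be inferred
    from the term. *)
Definition density of measurable_fun setT f & (forall x, 0 <= f x)
    & \int[mu]_x f x = 1 :=
  fun A : set T => \int[mu]_(x in A) f x.

Let dens := density mf f0 f1.

Let density0 : dens set0 = 0.
Proof. exact: integral_set0. Qed.

Let density_ge0 A : 0 <= dens A.
Proof. exact: integral_ge0. Qed.

Let density_sigma_additive : semi_sigma_additive dens.
Proof.
move=> F mF tF mUF; rewrite /dens /density ge0_integral_bigcup//; last first.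
  exact: measurable_funTS.
by apply: is_cvg_ereal_nneg_natsum_cond => n _ _; exact: integral_ge0.
Qed.

HB.instance Definition _ := isMeasure.Build _ _ _ dens
  density0 density_ge0 density_sigma_additive.

HB.instance Definition _ := Measure_isProbability.Build _ _ _ dens f1.

Definition density_prob : probability T R := dens.

End density.

(** Law of total probability: the inner sum is the conditional probability of A
    given a = k, times the probability of a = k. For a null label k the quotient
    is 0 by convention, in accordance with mu (A `&` a @^-1` [set k]) = 0. *)
Lemma esum_conditional d (T : measurableType d) (R : realType)
    (mu : probability T R) (K L : countType) (a : T -> K)
    (theta : K -> L -> \bar R) (A : set T) :
  measurable_fibers a ->
  (forall k, \esum_(l in setT) theta k l = mu (a @^-1` [set k])) ->
  measurable A -> (forall k l, 0 <= theta k l) ->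
  \esum_(k in setT) \esum_(l in setT)
    ((fine (mu (a @^-1` [set k])))^-1 * fine (mu (A `&` a @^-1` [set k])))%:E
      * theta k l = mu A.
Proof.
move=> ma thetaE mA theta0.
rewrite (measure_fibers mu ma mA); apply: eq_esum => k _.
have mAk : measurable (A `&` a @^-1` [set k]) by exact: measurableI.
set f := fine _; set r := fine _.
have fE : mu (a @^-1` [set k]) = f%:E by rewrite fineK// fin_num_measure.
have rE : mu (A `&` a @^-1` [set k]) = r%:E by rewrite fineK// fin_num_measure.
have f0 : (0 <= f)%R by exact: fine_ge0.
have r0 : (0 <= r)%R by exact: fine_ge0.
have rf : (r <= f)%R by rewrite -lee_fin -rE -fE le_measure ?inE.
rewrite esumZl ?mulr_ge0 ?invr_ge0// thetaE fE; apply: etrans (esym rE).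
rewrite -EFinM.
have [fk0|fk0] := eqVneq f 0%R; last by rewrite mulrAC mulVf// mul1r.
by congr EFin; apply/eqP; rewrite fk0 mulr0 eq_le r0 -fk0 rf.
Qed.

Section glue_along_labels.
Context d1 d2 (T1 : measurableType d1) (T2 : measurableType d2) (R : realType).
Variables (F : probability T1 R) (G : probability T2 R).
Variables (K L : countType) (a : T1 -> K) (b : T2 -> L).
Variables (ma : measurable_fibers a) (mb : measurable_fibers b).

(** Labels are drawn from theta, then the points independently from the
    conditional laws of F and G given their labels. This law has the density
    theta k l / (F (a = k) * G (b = l)) with respect to the product measure. *)
Lemma glue_along_labels (theta : K -> L -> \bar R) :
  (forall k l, 0 <= theta k l) ->
  (forall k, \esum_(l in setT) theta k l = F (a @^-1` [set k])) ->
  (forall l, \esum_(k in setT) theta k l = G (b @^-1` [set l])) ->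
  exists pi : probability (T1 * T2)%type R,
    [/\ forall A, measurable A -> pi (A `*` setT) = F A,
        forall B, measurable B -> pi (setT `*` B) = G B &
        forall k l, pi (a @^-1` [set k] `*` b @^-1` [set l]) = theta k l].
Proof.
move=> theta0 thetaF thetaG.
pose f k := fine (F (a @^-1` [set k])); pose g l := fine (G (b @^-1` [set l])).
have fE k : F (a @^-1` [set k]) = (f k)%:E by rewrite fineK// fin_num_measure.
have gE l : G (b @^-1` [set l]) = (g l)%:E by rewrite fineK// fin_num_measure.
have f0 k : (0 <= f k)%R by exact: fine_ge0.
have g0 l : (0 <= g l)%R by exact: fine_ge0.
have theta_lef k l : theta k l <= (f k)%:E.
  rewrite -fE -thetaF; apply: esum_ge; exists [set l]; first by split.
  by rewrite fsbig_set1.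
have theta_leg k l : theta k l <= (g l)%:E.
  rewrite -gE -thetaG; apply: esum_ge; exists [set k]; first by split.
  by rewrite fsbig_set1.
have thetaE k l : (fine (theta k l))%:E = theta k l.
  by rewrite fineK// ge0_fin_numE// (le_lt_trans (theta_lef k l))// ltry.
pose rho (e : K * L) := (f e.1)^-1%:E * ((g e.2)^-1%:E * theta e.1 e.2).
have rho0 e : 0 <= rho e by rewrite !mule_ge0// lee_fin invr_ge0.
(* the quotients by null labels cause no loss, since theta vanishes there *)
have fK k l : (f k)^-1%:E * (f k)%:E * theta k l = theta k l.
  have [fk0|fk0] := eqVneq (f k) 0%R; last by rewrite -EFinM mulVf// mul1e.
  suff -> : theta k l = 0 by rewrite mule0.
  by apply/eqP; rewrite eq_le theta0 andbT (le_trans (theta_lef k l))// fk0.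
have gK k l : (g l)^-1%:E * (g l)%:E * theta k l = theta k l.
  have [gl0|gl0] := eqVneq (g l) 0%R; last by rewrite -EFinM mulVf// mul1e.
  suff -> : theta k l = 0 by rewrite mule0.
  by apply/eqP; rewrite eq_le theta0 andbT (le_trans (theta_leg k l))// gl0.
pose ab (x : T1 * T2) := (a x.1, b x.2).
have mab : measurable_fibers ab.
  apply: measurable_fibers_pair => k.
    have := @measurable_fst _ _ T1 T2 measurableT _ (ma k); by rewrite setTI.
  by have := @measurable_snd _ _ T1 T2 measurableT _ (mb k); rewrite setTI.
have intE A B : measurable A -> measurable B ->
    \int[F \x G]_(x in A `*` B) rho (ab x) =
    \esum_(e in setT) rho e *
      (F (A `&` a @^-1` [set e.1]) * G (B `&` b @^-1` [set e.2])).
  move=> mA mB; rewrite (integral_fibers _ mab)//; last exact: measurableX.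
  apply: eq_esum => -[k l] _; congr (_ * _).
  rewrite -product_measure1E; [|exact: measurableI|exact: measurableI].
  congr product_measure1; apply/seteqP; split => -[x y] /=.
    by move=> [[Ax By] [<- <-]].
  by move=> [[Ax <-] [By <-]].
have rhoF A : measurable A -> \int[F \x G]_(x in A `*` setT) rho (ab x) = F A.
  move=> mA; rewrite intE// -(esum_conditional ma thetaF mA theta0).
  have -> : [set: K * L] = [set: K] `*`` (fun=> [set: L]) by apply/seteqP.
  rewrite esum_esum => [|k l _ _]; last first.
    by apply: mule_ge0 => //; rewrite lee_fin mulr_ge0 ?invr_ge0 ?fine_ge0.
  apply: eq_esum => -[k l] _ /=.
  rewrite setTI gE -[in RHS]gK -thetaE /rho /= -thetaE -/(f k).
  rewrite -[X in _ * (X * _)](@fineK _ (F _)) ?fin_num_measure//.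
    by rewrite -!EFinM; congr EFin; ring.
  exact: measurableI.
have rhoG B : measurable B -> \int[F \x G]_(x in setT `*` B) rho (ab x) = G B.
  move=> mB; rewrite intE//.
  rewrite -(esum_conditional (theta := fun l k => theta k l) mb thetaG mB
    (fun l k => theta0 k l)).
  rewrite (reindex_esum [set: L * K] setT (fun e => (e.2, e.1))); last first.
    by split => // [[? ?] [? ?] _ _ [-> ->]//|[k l] _]; exists (l, k).
  have -> : [set: L * K] = [set: L] `*`` (fun=> [set: K]) by apply/seteqP.
  rewrite esum_esum => [|l k _ _]; last first.
    by apply: mule_ge0 => //; rewrite lee_fin mulr_ge0 ?invr_ge0 ?fine_ge0.
  apply: eq_esum => -[l k] _ /=.
  rewrite setTI fE -[in RHS]fK -thetaE /rho /= -thetaE -/(g l).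
  rewrite -[X in _ * (_ * X)](@fineK _ (G _)) ?fin_num_measure//.
    by rewrite -!EFinM; congr EFin; ring.
  exact: measurableI.
have mrho : measurable_fun setT (rho \o ab) by exact: measurable_fun_fibers.
have rho1 : \int[F \x G]_x (rho \o ab) x = 1.
  by rewrite -[RHS](probability_setT F) -rhoF// setXTT.
exists (density_prob mrho (fun x => rho0 (ab x)) rho1); split.
- exact: rhoF.
- exact: rhoG.
move=> k l.
transitivity (\int[F \x G]_(x in a @^-1` [set k] `*` b @^-1` [set l])
  cst (rho (k, l)) x).
  by apply: eq_integral => x; rewrite inE /ab /= => -[/= -> ->].
rewrite integral_cst; last exact: measurableX.
transitivity (rho (k, l) * (F (a @^-1` [set k]) * G (b @^-1` [set l]))).
  by congr (_ * _); exact: product_measure1E.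
rewrite fE gE /rho /= -[RHS](fK k) -[in RHS](gK k l).
by rewrite -thetaE -!EFinM; congr EFin; ring.
Qed.
End glue_along_labels.

Section coupling_from_labels.
Variables (R : realType) (Z : ptopologicalType) (K : countType).
Variables (q : nat -> Z -> K) (L : countType) (a : Z -> L).
Hypothesis mq : forall n, @measurable_fibers _ (borelType Z) _ (q n).
Hypothesis sq : cells_shrink q.
Hypothesis ma : @measurable_fibers _ (borelType Z) _ a.

(** The law found on the product sigma-algebra lives on all Borel sets of Z * Z
    thanks to cells that shrink to points. *)
Lemma coupling_with_labels (F G : Prob R Z) (theta : L -> L -> \bar R) :
  (forall k l, 0 <= theta k l) ->
  (forall k, \esum_(l in setT) theta k l = F (a @^-1` [set k])) ->
  (forall l, \esum_(k in setT) theta k l = G (a @^-1` [set l])) ->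
  exists2 pi, coupling F G pi &
    forall k l, pi [set z | (a z.1, a z.2) = (k, l)] = theta k l.
Proof.
move=> theta0 tF tG.
have [pr [prF prG prE]] := @glue_along_labels _ _ (borelType Z) (borelType Z)
  R F G L L a a ma ma theta theta0 tF tG.
have mid := borel_prod_measurable mq mq sq sq.
pose idm : {mfun (borelType Z * borelType Z)%type >-> borelType (Z * Z)%type} :=
  HB.pack (id : borelType Z * borelType Z -> borelType (Z * Z)%type)
    (isMeasurableFun.Build _ _ _ _ _ mid).
pose pi : Prob R (Z * Z)%type := distribution pr idm.
have piE A : pi A = pr A by [].
exists pi.
  move=> A bA; rewrite !piE; split.
    rewrite -(prF _ bA); congr (pr _).
    by apply/seteqP; split => -[x y] //= [].
  rewrite -(prG _ bA); congr (pr _).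
  by apply/seteqP; split => -[x y] //= [].
move=> k l; rewrite piE -(prE k l); congr (pr _).
by apply/seteqP; split => -[x y] /= [-> ->].
Qed.

End coupling_from_labels.

(** * Couplings of the empirical laws from couplings of the laws *)

Lemma continuous_prod_map (T1 T2 U1 U2 : topologicalType) (f : T1 -> U1)
    (g : T2 -> U2) : continuous f -> continuous g ->
  continuous (fun z : T1 * T2 => (f z.1, g z.2)).
Proof.
move=> cf cg z; apply: cvg_pair.
  by apply: (@continuous_comp _ _ _ fst f); [exact: cvg_fst|exact: cf].
by apply: (@continuous_comp _ _ _ snd g); [exact: cvg_snd|exact: cg].
Qed.

Section average_dirac.
Context d (T : measurableType d) (R : realType).
Variables (N : nat) (N0 : (0 < N)%N) (x : 'I_N -> T).

Let invN_ge0 : (0 <= (N%:R^-1 : R))%R. Proof. by rewrite invr_ge0. Qed.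

(* [insubd] extends the finite family to a sequence, as [msum] expects *)
Let comp (k : nat) : {measure set T -> \bar R} :=
  \d_(x (insubd (Ordinal N0) k)).

Definition average_dirac := mscale (NngNum invN_ge0) (msum comp N).

HB.instance Definition _ := Measure.on average_dirac.

Lemma average_diracE A :
  average_dirac A = N%:R^-1%:E * \sum_(i < N) \d_(x i) A.
Proof.
congr (_ * _); apply: eq_bigr => i _.
by rewrite /comp valKd.
Qed.

Let average_dirac_setT : average_dirac setT = 1.
Proof.
rewrite average_diracE; under eq_bigr do rewrite diracT.
by rewrite sumEFin sumr_const card_ord -EFinM mulVf// pnatr_eq0 -lt0n.
Qed.

HB.instance Definition _ := Measure_isProbability.Build _ _ _
  average_dirac average_dirac_setT.

Lemma ge0_integral_average_dirac (f : T -> \bar R) :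
  measurable_fun setT f -> (forall z, 0 <= f z) ->
  \int[average_dirac]_z f z = N%:R^-1%:E * \sum_(i < N) f (x i).
Proof.
move=> mf f0; rewrite ge0_integral_mscale// ge0_integral_measure_sum//.
congr (_ * _); apply: eq_bigr => i _; rewrite integral_dirac// diracT mul1e.
by rewrite valKd.
Qed.

Definition average_dirac_prob : probability T R := average_dirac.

End average_dirac.

Section wasserstein_ge.
Variables (R : realType) (d N : nat) (N0 : (0 < N)%N).
Variables (E : set 'rV[R]_d) (E0 : E !=set0).
Local Notation Et := (nonempty_subset E0).
Local Notation EN := {ptws 'I_N -> Et}.

Lemma W1_ge0 (mu nu : Prob R Et) : 0 <= W1 mu nu.
Proof.
apply: le_ereal_inf_tmp => _ [pi _ <-]; apply: integral_ge0 => z _.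
by rewrite lee_fin truncated_dist_ge0.
Qed.

Lemma W1_empirical_le (X Y : EN) :
  W1 (empirical N0 X) (empirical N0 Y) <= (normalized_dist X Y)%:E.
Proof.
pose XY i : borelType (Et * Et)%type := (X i, Y i).
pose pi : Prob R (Et * Et)%type := average_dirac_prob R N0 XY.
have piE A : pi A = N%:R^-1%:E * \sum_(i < N) \d_(XY i) A.
  exact: average_diracE.
apply: ereal_inf_lbound; exists pi.
  move=> A _; split; rewrite piE; congr (_ * _); apply: eq_bigr => i _;
    by rewrite /dirac !indicE; congr ((_ %:R)%:E); apply: asbool_equiv_eq.
rewrite ge0_integral_average_dirac; last 2 first.
- apply/measurable_EFinP; apply: continuous_borel_measurableR.
  exact: truncated_dist_continuous.
- by move=> z; rewrite lee_fin truncated_dist_ge0.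
by rewrite sumEFin -EFinM.
Qed.

Let empirical2 (z : borelType (EN * EN)%type) :
    borelType (Prob R Et * Prob R Et)%type :=
  (empirical N0 z.1, empirical N0 z.2).

Let empirical2_measurable : measurable_fun setT empirical2.
Proof.
apply: (@continuous_borel_measurable (EN * EN)%type
  (Prob R Et * Prob R Et)%type).
by apply: continuous_prod_map; exact: empirical_continuous.
Qed.

HB.instance Definition _ := isMeasurableFun.Build _ _ _ _
  empirical2 empirical2_measurable.

Lemma borel_empirical_preimage A :
  borel A -> borel (empirical N0 @^-1` A : set EN).
Proof. by apply: borel_preimage; exact: empirical_continuous. Qed.

Lemma calW1_empirical_le (F G : Prob R EN) :
  calW1 (empirical_law N0 F) (empirical_law N0 G) <= W1_pow F G.
Proof.
apply: le_ereal_inf_tmp => _ [pi piFG <-].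
pose pi' : Prob R (Prob R Et * Prob R Et)%type := distribution pi empirical2.
apply: (@le_trans _ _ (\int[pi']_z W1 z.1 z.2)).
  apply: ereal_inf_lbound; exists pi' => //.
  by move=> A bA; exact: (piFG (empirical N0 @^-1` A)
    (borel_empirical_preimage bA)).
apply: (@le_trans _ _ (\int[pi]_z W1 (empirical N0 z.1) (empirical N0 z.2))).
  apply: (@lower_integral_pushforward _ _ (borelType (EN * EN)%type)
    (borelType (Prob R Et * Prob R Et)%type) R pi pi' empirical2
    (fun z => W1 z.1 z.2)).
  - exact: empirical2_measurable.
  - by [].
  - by move=> z; exact: W1_ge0.
apply: le_lower_integral => z; first exact: W1_ge0.
exact: W1_empirical_le.
Qed.

End wasserstein_ge.

(** * Types of empirical measures *)

Lemma perm_of_counts (N : nat) (K : eqType) (t u : 'I_N -> K) :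
  (forall k, #|[pred i | t i == k]| = #|[pred i | u i == k]|) ->
  exists s : 'S_N, forall i, t i = u (s i).
Proof.
move=> tu.
have cntE (v : 'I_N -> K) k :
    count_mem k [tuple v i | i < N] = #|[pred i | v i == k]|.
  by rewrite /= count_map -sum1_count -sum1_card big_enum_cond.
have /tuple_permP[s /val_inj sE] :
    perm_eq [tuple t i | i < N] [tuple u i | i < N].
  by apply/allP => k _ /=; apply/eqP; rewrite !cntE.
exists s => i.
by have := congr1 (fun x => tnth x i) sE; rewrite !tnth_mktuple.
Qed.

Definition occurrences (N : nat) (K : eqType) (t : 'I_N -> K) (k : K) : nat :=
  #|[pred i | t i == k]|.

Lemma occurrences_gt0 (N : nat) (K : eqType) (t : 'I_N -> K) i :
  (0 < occurrences t (t i))%N.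
Proof. by apply/card_gt0P; exists i; rewrite inE. Qed.

(** Weighting every index by the inverse of the multiplicity of its label counts
    each label once. *)
Lemma sum_occurrencesV (R : realType) (N : nat) (K : eqType) (t : 'I_N -> K) k :
  (\sum_(i < N) (occurrences t (t i))%:R^-1 * (t i == k)%:R =
   (0 < occurrences t k)%N%:R :> R)%R.
Proof.
rewrite (eq_bigr
  (fun i => (occurrences t k)%:R^-1 * (t i == k)%:R)%R); last first.
  by move=> i _; case: eqP => [->//|_]; rewrite !mulr0.
rewrite -mulr_sumr.
rewrite (_ : \sum_i (t i == k)%:R = (occurrences t k)%:R)%R; last first.
  rewrite -natr_sum /occurrences -sum1_card [in RHS]big_mkcond/=.
  by congr (_%:R)%R; apply: eq_bigr => i _; rewrite inE; case: eqP.
have [->|n0] := posnP (occurrences t k); first by rewrite mulr0.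
by rewrite mulVf// pnatr_eq0 -lt0n.
Qed.

Lemma sum_measure_occurrences d (T : measurableType d) (R : realType)
    (mu : {measure set T -> \bar R}) (N : nat) (K : countType) (b : T -> K)
    (B : set T) (t : 'I_N -> K) : measurable_fibers b -> measurable B ->
  \sum_i (occurrences t (t i))%:R^-1%:E * mu (B `&` b @^-1` [set t i]) =
  mu (B `&` [set z | (0 < occurrences t (b z))%N]).
Proof.
move=> mb mB; rewrite -integral_sum_indic => [|i|i]; last 2 first.
- by rewrite invr_ge0.
- exact: measurableI.
have mA : measurable [set z | (0 < occurrences t (b z))%N].
  exact: (measurable_fibers_preimage [set k | (0 < occurrences t k)%N] mb).
have mBA := measurableI _ _ mB mA.
rewrite -[X in mu X]setIT -integral_indic//; apply: eq_integral => z _.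
rewrite indicI; congr EFin => /=.
rewrite (eq_bigr (fun i =>
    \1_B z * ((occurrences t (t i))%:R^-1 * (t i == b z)%:R))%R); last first.
  move=> i _; rewrite indicI/= mulrCA; congr (_ * (_ * _))%R.
  rewrite indicE; congr (_%:R)%R; congr nat_of_bool.
  by apply/idP/idP => [/set_mem /= ->//|/eqP tb]; apply/mem_set => /=.
rewrite -mulr_sumr sum_occurrencesV; congr (_ * _)%R.
rewrite indicE; congr (_%:R)%R; congr nat_of_bool.
by apply/idP/idP => [h|/set_mem//]; exact: mem_set.
Qed.

Section type_of_measure.
Variables (R : realType) (Z : ptopologicalType) (K : countType) (q : Z -> K).
Hypothesis mq : @measurable_fibers _ (borelType Z) _ q.
Variable N : nat.
Hypothesis N0 : (0 < N)%N.

(** The measure mu gives to every cell the mass that the empirical measure of N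
    points with labels t gives to it; mu itself need not be empirical. *)
Definition has_type (mu : Prob R Z) (t : 'I_N -> K) :=
  forall k, mu (q @^-1` [set k]) = (N%:R^-1 * (occurrences t k)%:R)%:E.

Let P (mu : Prob R Z) : probability (borelType Z) R := mu.

(** The cells carrying a label of t already have total mass 1. *)
Lemma has_type_full mu t : has_type mu t ->
  P mu [set x | occurrences t (q x) = 0%N] = 0.
Proof.
move=> mut.
pose A := [set x : borelType Z | (0 < occurrences t (q x))%N].
have mA : measurable A.
  exact: (measurable_fibers_preimage [set k | (0 < occurrences t k)%N] mq).
have -> : [set x | occurrences t (q x) = 0%N] = ~` A.
  by apply/seteqP; split => x /=; rewrite /A /= lt0n;
    [move=> ->|move=> /negP; rewrite negbK => /eqP].
suff PA : P mu A = 1 by rewrite probability_setC// PA subee.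
rewrite -[A]setTI -sum_measure_occurrences//.
rewrite (eq_bigr (fun=> N%:R^-1%:E)) => [|i _].
  rewrite sumEFin sumr_const card_ord -[X in X%:E]mulr_natr mulVf//.
  by rewrite pnatr_eq0 -lt0n.
rewrite setTI; have /= -> := mut (t i).
rewrite -EFinM mulrCA mulVf ?mulr1// pnatr_eq0 -lt0n.
exact: occurrences_gt0.
Qed.

Variables (c : K -> K -> R).
Hypothesis c0 : forall k l, (0 <= c k l)%R.

(** The mass that gamma gives to a product of two cells is shared equally among
    the pairs of indices (i, j) that carry the corresponding labels. The matrix
    w obtained in this way has row and column sums 1 / N, so that the assignment
    inequality applies to it. *)
Lemma coupling_cost_ge (mu nu : Prob R Z) (t u : 'I_N -> K) (s : 'S_N)
    (gamma : Prob R (Z * Z)%type) :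
  has_type mu t -> has_type nu u -> coupling mu nu gamma ->
  (forall s' : 'S_N,
    \sum_i c (t i) (u (s i)) <= \sum_i c (t i) (u (s' i)))%R ->
  (N%:R^-1 * \sum_i c (t i) (u (s i)))%:E <=
  \int[gamma]_(z in [set: borelType (Z * Z)%type]) (c (q z.1) (q z.2))%:E.
Proof.
move=> mut nuu cg smin.
pose G : probability (borelType (Z * Z)%type) R := gamma.
have mq1 : @measurable_fibers _ (borelType (Z * Z)%type) _ (fun z => q z.1).
  by move=> k; exact: borel_fst (mq k).
have mq2 : @measurable_fibers _ (borelType (Z * Z)%type) _ (fun z => q z.2).
  by move=> k; exact: borel_snd (mq k).
have [g1 g2] : (forall A, borel A -> G (fst @^-1` A) = mu A) /\
    (forall A, borel A -> G (snd @^-1` A) = nu A).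
  by split=> A bA; have [] := cg A bA.
pose S i j : set (borelType (Z * Z)%type) :=
  [set z | q z.1 = t i] `&` [set z | q z.2 = u j].
have mS i j : measurable (S i j) by apply: measurableI; [exact: mq1|exact: mq2].
pose g i j := fine (G (S i j)).
have gE i j : G (S i j) = (g i j)%:E by rewrite fineK// fin_num_measure.
have g0 i j : (0 <= g i j)%R by exact: fine_ge0.
pose n i : R := (occurrences t (t i))%:R^-1%R.
pose m j : R := (occurrences u (u j))%:R^-1%R.
have n0 i : (0 <= n i)%R by rewrite invr_ge0.
have m0 j : (0 <= m j)%R by rewrite invr_ge0.
pose w i j := (g i j * (n i * m j))%R.
have indS i j z : \1_(S i j) z = ((t i == q z.1)%:R * (u j == q z.2)%:R)%R :> R.
  rewrite indicI; congr (_ * _)%R; rewrite indicE; congr (_%:R)%R;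
    by congr nat_of_bool; apply/idP/idP => [/set_mem /= ->//|/eqP e];
      apply/mem_set.
have mocc (b : borelType (Z * Z)%type -> K) (v : 'I_N -> K) :
    measurable_fibers b -> measurable [set z | (0 < occurrences v (b z))%N].
  exact: (measurable_fibers_preimage [set k | (0 < occurrences v k)%N]).
have bocc (v : 'I_N -> K) : borel [set x : Z | occurrences v (q x) = 0%N].
  exact: (measurable_fibers_preimage [set k | occurrences v k = 0%N] mq).
have fullI (b : borelType (Z * Z)%type -> K) (v : 'I_N -> K) B :
    measurable_fibers b -> measurable B ->
    G [set z | occurrences v (b z) = 0%N] = 0 ->
    G (B `&` [set z | (0 < occurrences v (b z))%N]) = G B.
  move=> mb mB b0; rewrite [RHS](measureDI G mB (mocc b v mb)).
  rewrite [X in X + _](_ : _ = 0) ?add0e//.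
  apply: subset_measure0 b0.
  - by apply: measurableD => //; exact: mocc.
  - exact: (measurable_fibers_preimage [set k | occurrences v k = 0%N] mb).
  - by move=> z [_ /negP]; rewrite -eqn0Ngt => /eqP.
have nV (v : 'I_N -> K) i :
    ((occurrences v (v i))%:R^-1 * (N%:R^-1 * (occurrences v (v i))%:R) =
     N%:R^-1 :> R)%R.
  rewrite mulrCA mulVf ?mulr1// pnatr_eq0 -lt0n; exact: occurrences_gt0.
have row i : (\sum_j w i j = N%:R^-1)%R.
  apply: EFin_inj; rewrite -sumEFin.
  transitivity ((n i)%:E * \sum_j (m j)%:E * G (S i j)).
    rewrite ge0_sume_distrr => [|j _]; last first.
      by apply: mule_ge0 => //; rewrite lee_fin.
    by apply: eq_bigr => j _; rewrite gE -!EFinM; congr EFin; rewrite /w; ring.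
  have u0 : G (snd @^-1` [set x : Z | occurrences u (q x) = 0%N]) = 0.
    by rewrite g2//; exact: has_type_full.
  have h := etrans (sum_measure_occurrences G u mq2 (mq1 (t i)))
    (fullI _ u _ mq2 (mq1 (t i)) u0).
  have h' := etrans (g1 _ (mq (t i))) (mut (t i)).
  by rewrite (etrans h h') -EFinM nV.
have col j : (\sum_i w i j = N%:R^-1)%R.
  apply: EFin_inj; rewrite -sumEFin.
  transitivity ((m j)%:E * \sum_i (n i)%:E * G (S i j)).
    rewrite ge0_sume_distrr => [|i _]; last first.
      by apply: mule_ge0 => //; rewrite lee_fin.
    by apply: eq_bigr => i _; rewrite gE -!EFinM; congr EFin; rewrite /w; ring.
  have t0 : G (fst @^-1` [set x : Z | occurrences t (q x) = 0%N]) = 0.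
    by rewrite g1//; exact: has_type_full.
  have h := etrans (sum_measure_occurrences G t mq1 (mq2 (u j)))
    (fullI _ t _ mq1 (mq2 (u j)) t0).
  have h' := etrans (g2 _ (mq (u j))) (nuu (u j)).
  rewrite -(nV u j) EFinM -(etrans h h'); congr (_ * _).
  by apply: eq_bigr => i _; rewrite /S setIC.
apply: (@le_trans _ _ (\sum_i \sum_j w i j * c (t i) (u j))%R%:E).
  rewrite lee_fin.
  apply: (@assignment_le R 'I_N w (fun i j => c (t i) (u j))) => //.
  by move=> i j; rewrite /w !mulr_ge0.
pose a (e : 'I_N * 'I_N) := (n e.1 * m e.2 * c (t e.1) (u e.2))%R.
have -> : (\sum_i \sum_j w i j * c (t i) (u j))%R%:E =
    \int[G]_z (\sum_(e : 'I_N * 'I_N) a e * \1_(S e.1 e.2) z)%:E.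
  rewrite integral_sum_indic//; last by move=> e; rewrite /a !mulr_ge0.
  rewrite pair_bigA/= -sumEFin; apply: eq_bigr => -[i j] _ /=.
  by rewrite gE -EFinM; congr EFin; rewrite /w /a /=; ring.
apply: le_lower_integral => z.
  rewrite lee_fin; apply: sumr_ge0 => e _; apply: mulr_ge0 => //.
  by rewrite /a !mulr_ge0.
rewrite lee_fin.
have -> : (\sum_(e : 'I_N * 'I_N) a e * \1_(S e.1 e.2) z =
  c (q z.1) (q z.2) * ((\sum_i n i * (t i == q z.1)%:R) *
                       (\sum_j m j * (u j == q z.2)%:R)))%R.
  rewrite big_distrlr/= pair_bigA/= mulr_sumr; apply: eq_bigr => -[i j] _ /=.
  rewrite indS /a /=; case: eqP => [->|_] /=; last by ring.
  by case: eqP => [->|_] /=; ring.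
rewrite /n /m !sum_occurrencesV ler_piMr// -natrM.
by rewrite (ler_nat R _ 1); do 2!case: (0 < _)%N.
Qed.

End type_of_measure.

Definition permute (N : nat) (K : Type) (t : {ffun 'I_N -> K}) (s : 'S_N) :
  {ffun 'I_N -> K} := [ffun i => t (s i)].

Lemma permuteM (N : nat) (K : Type) (t : {ffun 'I_N -> K}) (s s' : 'S_N) :
  permute (permute t s) s' = permute t (s' * s).
Proof. by apply/ffunP => i; rewrite !ffunE permM. Qed.

Section types.
Variables (R : realType) (d N : nat) (N0 : (0 < N)%N).
Variables (E : set 'rV[R]_d) (E0 : E !=set0).
Local Notation Et := (nonempty_subset E0).
Local Notation EN := {ptws 'I_N -> Et}.
Variables (K : countType) (q : Et -> K).
Hypothesis cq : forall k, continuous_limit R (q @^-1` [set k]).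

Let mq : @measurable_fibers _ (borelType Et) _ q.
Proof. by move=> k; exact: continuous_limit_borel (cq k). Qed.

Definition labels (X : EN) : {ffun 'I_N -> K} := [ffun i => q (X i)].

Lemma labels_fibers : @measurable_fibers _ (borelType EN) _ labels.
Proof.
move=> t.
have -> : labels @^-1` [set t] =
    \bigcap_(i in [set: 'I_N]) [set X : EN | q (X i) = t i].
  apply/seteqP; split => X /=.
    by move=> <- i _; rewrite /= ffunE.
  by move=> Xt; apply/ffunP => i; rewrite ffunE; exact: Xt.
apply: fin_bigcap_measurable; first exact: finite_finset.
move=> i _; apply: borel_preimage (mq (t i)).
exact: (@proj_continuous _ (fun=> Et) i).
Qed.

Lemma has_type_empirical (X : EN) : has_type q (empirical N0 X) (labels X).
Proof.
move=> k; rewrite EFinM; congr (_ * _).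
rewrite (eq_bigr (fun i => ((labels X i == k)%:R)%:E)) => [|i _].
  rewrite sumEFin -natr_sum /occurrences -sum1_card [in RHS]big_mkcond/=.
  by congr (_%:R)%:E; apply: eq_bigr => i _; rewrite inE; case: eqP.
rewrite /dirac indicE; congr (_%:R)%:E; congr nat_of_bool; rewrite ffunE.
by apply/idP/eqP => [/set_mem|h]; [|apply/mem_set].
Qed.

Lemma has_type_perm (mu : Prob R Et) (t u : {ffun 'I_N -> K}) :
  has_type q mu t -> has_type q mu u -> exists s, t = permute u s.
Proof.
move=> mut muu; have [k|s tu] := @perm_of_counts N K t u.
  have := mut k; rewrite muu => -[] /(mulfI _) h.
  apply/eqP; rewrite -(eqr_nat R) eq_sym; apply/eqP; apply: h.
  by rewrite invr_eq0 pnatr_eq0 -lt0n.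
by exists s; apply/ffunP => i; rewrite ffunE tu.
Qed.

Lemma measurable_has_type (t : {ffun 'I_N -> K}) :
  borel [set mu : Prob R Et | has_type q mu t].
Proof.
have -> : [set mu : Prob R Et | has_type q mu t] = ~` \bigcup_k
    ~` [set mu : Prob R Et | mu (q @^-1` [set k])
                       = (N%:R^-1 * (occurrences t k)%:R)%:E].
  rewrite -setC_bigcap setCK; apply/seteqP.
  by split => mu h k; [move=> _; exact: h|exact: h].
apply: (@measurableC _ (borelType (Prob R Et))).
apply: countable_bigcupT_measurable; first exact: countableP.
move=> k; apply: measurableC; rewrite -[X in measurable X]setTI.
exact: (measurable_eval_continuous_limit (cq k) measurableT
  (emeasurable_set1 _)).
Qed.

(** The list p (emp X) is a rearrangement of the labels of X, by a permutation
    that depends on X; a uniform shuffle absorbs this permutation, and the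
    symmetry of F then makes the shuffle of the labels of X superfluous. *)
Lemma symmetric_types (F : Prob R EN) (p : Prob R Et -> {ffun 'I_N -> K}) :
  symmetric_prob F -> @measurable_fibers _ (borelType (Prob R Et)) _ p ->
  (forall X : EN, has_type q (empirical N0 X) (p (empirical N0 X))) ->
  forall t, #|'S_N|%:R^-1%:E *
    \sum_(s : 'S_N) empirical_law N0 F [set mu | permute (p mu) s = t] =
  F (labels @^-1` [set t]).
Proof.
move=> symF mp pX t.
pose P : probability (borelType EN) R := F.
have mpX : @measurable_fibers _ (borelType EN) _
    (fun X : EN => p (empirical N0 X)).
  by move=> u; exact: (borel_empirical_preimage N0 (mp u)).
transitivity (#|'S_N|%:R^-1%:E *
    \sum_(s : 'S_N) P [set X | permute (labels X) s = t]).
  congr (_ * _).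
  apply: (@sum_measure_perm _ (borelType EN) R P _
    (fun s => [set X | permute (p (empirical N0 X)) s = t])
    (fun s => [set X | permute (labels X) s = t])).
  - move=> s.
    exact: (measurable_fibers_preimage [set u | permute u s = t] mpX).
  - move=> s.
    exact: (measurable_fibers_preimage [set u | permute u s = t] labels_fibers).
  - move=> X; have [s pE] := has_type_perm (pX X) (has_type_empirical X).
    by exists s => s'; rewrite /= pE permuteM.
rewrite (eq_bigr (fun=> P (labels @^-1` [set t]))) => [|s _].
  have [r rE] : exists r, P (labels @^-1` [set t]) = r%:E.
    exists (fine (P (labels @^-1` [set t]))).
    by rewrite fineK// fin_num_measure//; exact: labels_fibers.
  rewrite rE sumEFin sumr_const -EFinM -[(r *+ _)%R]mulr_natr.
  rewrite mulrCA mulVf ?mulr1//.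
  by rewrite pnatr_eq0 -lt0n card_Sn fact_gt0.
rewrite -[RHS](symF s _ (labels_fibers t)).
by congr (P _); apply/seteqP; split => X /= <-; apply/ffunP => i;
  rewrite !ffunE.
Qed.

End types.

(** * Couplings of the laws from couplings of the empirical laws *)

Section wasserstein_le.
Variables (R : realType) (d N : nat) (N0 : (0 < N)%N).
Variables (E : set 'rV[R]_d) (E0 : E !=set0).
Local Notation Et := (nonempty_subset E0).
Local Notation EN := {ptws 'I_N -> Et}.
Variables (F G : Prob R EN) (symF : symmetric_prob F) (symG : symmetric_prob G).

Variables (n : nat) (e : R).
Hypothesis osc : forall x y x' y' : Et, cell n x = cell n x' ->
  cell n y = cell n y' -> (truncated_dist x y <= truncated_dist x' y' + e)%R.

Let K : countType := {ffun 'I_d -> int}.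
Let q : Et -> K := cell n.
Local Notation T := {ffun 'I_N -> K}.

(** For a label without points the value is arbitrary. *)
Definition cell_point (k : K) : Et := xget point (q @^-1` [set k]).

Let cell_pointK x : q (cell_point (q x)) = q x.
Proof.
by rewrite /cell_point; apply: (@xgetI _ point (q @^-1` [set q x]) x).
Qed.

Definition cell_dist (k l : K) : R :=
  truncated_dist (cell_point k) (cell_point l).

Let cell_dist_ge0 k l : (0 <= cell_dist k l)%R.
Proof. exact: truncated_dist_ge0. Qed.

Let le_cell_dist x y : (truncated_dist x y <= cell_dist (q x) (q y) + e)%R.
Proof. by apply: osc; rewrite -/q cell_pointK. Qed.

Let cell_dist_le x y : (cell_dist (q x) (q y) <= truncated_dist x y + e)%R.
Proof. by apply: osc; rewrite -/q cell_pointK. Qed.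

Let e0 : (0 <= e)%R.
Proof.
have := osc (erefl (cell n (point : Et))) (erefl (cell n (point : Et))).
by rewrite lerDl.
Qed.

Definition label_dist (t u : T) : R :=
  (N%:R^-1 * \sum_i cell_dist (t i) (u i))%R.

Let label_dist_ge0 t u : (0 <= label_dist t u)%R.
Proof. by rewrite mulr_ge0 ?invr_ge0 ?sumr_ge0. Qed.

Let label_dist_permute t u s :
  label_dist (permute t s) (permute u s) = label_dist t u.
Proof.
congr (_ * _)%R; rewrite [RHS](reindex_inj (@perm_inj _ s)).
by apply: eq_bigr => i _; rewrite !ffunE.
Qed.

Definition best_perm (t u : T) : 'S_N :=
  [arg min_(s < (1%g : 'S_N)) label_dist t (permute u s)]%O.

Let best_permP t u s :
  (label_dist t (permute u (best_perm t u)) <= label_dist t (permute u s))%R.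
Proof. by rewrite /best_perm; case: arg_minP => // s' _; apply. Qed.

Definition best_dist t u := label_dist t (permute u (best_perm t u)).

Let cq k : continuous_limit R (q @^-1` [set k]).
Proof. exact: continuous_limit_cell. Qed.

Let mq : @measurable_fibers _ (borelType Et) _ q.
Proof. by move=> k; exact: continuous_limit_borel (cq k). Qed.

Lemma normalized_dist_le (X Y : EN) :
  (normalized_dist X Y <= label_dist (labels q X) (labels q Y) + e)%R.
Proof.
rewrite /normalized_dist /label_dist.
have -> : e = (N%:R^-1 * \sum_(i < N) e)%R.
  rewrite sumr_const card_ord -[(e *+ _)%R]mulr_natr mulrCA mulVf ?mulr1//.
  by rewrite pnatr_eq0 -lt0n.
rewrite -mulrDr -big_split/= ler_wpM2l ?invr_ge0//; apply: ler_sum => i _.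
by rewrite !ffunE.
Qed.

(** Replacing the cost by its value between cells changes the cost of a
    coupling by at most e, and the cost between cells is bounded from below by
    that of the best permutation. *)
Lemma best_dist_le_W1 (mu nu : Prob R Et) (t u : T) :
  has_type q mu t -> has_type q nu u -> (best_dist t u - e)%:E <= W1 mu nu.
Proof.
move=> mut nuu; apply: le_ereal_inf_tmp => _ [gamma cg <-].
pose P : probability (borelType (Et * Et)%type) R := gamma.
rewrite EFinB leeBlDr//.
have h : (best_dist t u)%:E <= \int[P]_z (cell_dist (q z.1) (q z.2))%:E.
  have := coupling_cost_ge mq N0 cell_dist_ge0 (s := best_perm t u) mut nuu cg.
  rewrite /best_dist /label_dist.
  under [in X in _ -> X]eq_bigr do rewrite ffunE.
  apply => s'; have := best_permP t u s'.
  rewrite /label_dist ler_pM2l ?invr_gt0 ?ltr0n//.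
  under eq_bigr do rewrite ffunE.
  by under [leRHS]eq_bigr do rewrite ffunE.
apply: le_trans h _.
have mc : measurable_fun setT
    (fun z : borelType (Et * Et)%type => (truncated_dist z.1 z.2)%:E).
  apply/measurable_EFinP; apply: continuous_borel_measurableR.
  exact: truncated_dist_continuous.
apply: (@le_trans _ _ (\int[P]_z ((truncated_dist z.1 z.2)%:E + e%:E))).
  apply: le_lower_integral => z; first by rewrite lee_fin.
  by rewrite -EFinD lee_fin.
rewrite (integral_addr_cst P e0 mc)// => z.
by rewrite lee_fin truncated_dist_ge0.
Qed.

Section coupling_given.
Variable Pi : Prob R (Prob R Et * Prob R Et)%type.
Hypothesis Pi_coupling : coupling (empirical_law N0 F) (empirical_law N0 G) Pi.

Variable p : Prob R Et -> T.
Hypothesis mp : @measurable_fibers _ (borelType (Prob R Et)) _ p.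
Hypothesis p_type : forall mu,
  (exists t : T, has_type q mu t) -> has_type q mu (p mu).

Let B := borelType (Prob R Et * Prob R Et)%type.
Let P : probability B R := Pi.

Let Pi1 A : borel A -> P (fst @^-1` A) = empirical_law N0 F A.
Proof. by move=> bA; have [] := Pi_coupling bA. Qed.

Let Pi2 A : borel A -> P (snd @^-1` A) = empirical_law N0 G A.
Proof. by move=> bA; have [] := Pi_coupling bA. Qed.

Let pX (X : EN) : has_type q (empirical N0 X) (p (empirical N0 X)).
Proof. by apply: p_type; exists (labels q X); exact: has_type_empirical. Qed.

Let mp1 : measurable_fibers (fun z : B => p z.1).
Proof. by move=> k; exact: borel_fst (mp k). Qed.

Let mp2 : measurable_fibers (fun z : B => p z.2).
Proof. by move=> k; exact: borel_snd (mp k). Qed.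

(** Draw a pair of measures from Pi and read off the labels of both; rearrange
    the second family optimally with respect to the first, then shuffle both
    by one and the same uniform permutation. The shuffle keeps the cost and
    gives each family the law of the labels of F, respectively of G, so the
    joint law theta lifts to a coupling of F and G. *)
Lemma exists_coupling_best_dist : exists2 pi, coupling F G pi &
  \int[pi]_(z in [set: borelType (EN * EN)%type])
    (label_dist (labels q z.1) (labels q z.2))%:E =
  \int[Pi]_(z in [set: B]) (best_dist (p z.1) (p z.2))%:E.
Proof.
pose first s (z : B) := permute (p z.1) s.
pose second s (z : B) :=
  permute (permute (p z.2) (best_perm (p z.1) (p z.2))) s.
have mfirst s : measurable_fibers (first s).
  move=> t.
  exact: (measurable_fibers_preimage [set u | permute u s = t] mp1).
have msecond s : measurable_fibers (second s).
  move=> t; exact: (measurable_fibers_preimage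
   [set tu | permute (permute tu.2 (best_perm tu.1 tu.2)) s = t]
   (measurable_fibers_pair mp1 mp2)).
have mpair s := measurable_fibers_pair (mfirst s) (msecond s).
pose cS : R := (#|'S_N|%:R^-1)%R.
have cS0 : (0 <= cS)%R by rewrite invr_ge0.
pose theta t u := cS%:E *
  \sum_(s : 'S_N) P [set z | (first s z, second s z) = (t, u)].
have theta0 t u : 0 <= theta t u.
  by apply: mule_ge0; [rewrite lee_fin|apply: sume_ge0].
have thetaF t : \esum_(u in setT) theta t u = F (labels q @^-1` [set t]).
  rewrite esumZl// => [|u]; last by apply: sume_ge0.
  rewrite esum_sum//.
  rewrite -(symmetric_types cq symF mp pX); congr (_ * _).
  apply: eq_bigr => s _.
  rewrite -(@Pi1 [set mu | permute (p mu) s = t]); last first.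
    exact: (measurable_fibers_preimage [set u | permute u s = t] mp).
  rewrite (measure_fibers P (msecond s) (mfirst s t)).
  apply: eq_esum => u _; congr (P _).
  by apply/seteqP; split => z /= [-> ->].
have thetaG u : \esum_(t in setT) theta t u = G (labels q @^-1` [set u]).
  rewrite esumZl// => [|t]; last by apply: sume_ge0.
  rewrite esum_sum//.
  rewrite -(symmetric_types cq symG mp pX); congr (_ * _).
  transitivity (\sum_(s : 'S_N) P (second s @^-1` [set u])).
    apply: eq_bigr => s _.
    rewrite (measure_fibers P (mfirst s) (msecond s u)).
    apply: eq_esum => t _; congr (P _).
    by apply/seteqP; split => z /= [-> ->].
  (* the optimal rearrangement depends on z, but the shuffle absorbs it *)
  transitivity (\sum_(s : 'S_N) P [set z | permute (p z.2) s = u]).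
    apply: sum_measure_perm => [s|s|z]; first exact: msecond.
      exact: (measurable_fibers_preimage [set t | permute t s = u] mp2).
    by exists (best_perm (p z.1) (p z.2)) => s; rewrite /second /= permuteM.
  apply: eq_bigr => s _.
  rewrite -(@Pi2 [set mu | permute (p mu) s = u])//.
  exact: (measurable_fibers_preimage [set t | permute t s = u] mp).
have cell_fibers m : @measurable_fibers _ (borelType EN) _
    (fun X : EN => labels (cell m) X).
  by apply: labels_fibers => k; exact: continuous_limit_cell.
have [pi piFG piE] := coupling_with_labels cell_fibers
  (cells_shrink_ptws (@cell_shrink R d E E0)) (labels_fibers cq)
  theta0 thetaF thetaG.
pose Q : probability (borelType (EN * EN)%type) R := pi.
have ldist0 (tu : T * T) : 0 <= (label_dist tu.1 tu.2)%:E by rewrite lee_fin.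
have mlabels : @measurable_fibers _ (borelType (EN * EN)%type) _
    (fun z => (labels q z.1, labels q z.2)).
  apply: measurable_fibers_pair => k.
    exact: borel_fst (labels_fibers cq k).
  exact: borel_snd (labels_fibers cq k).
exists pi => //.
rewrite (integral_fibers Q (g := fun tu : T * T => (label_dist tu.1 tu.2)%:E)
  mlabels)//.
transitivity (cS%:E * \sum_(s : 'S_N) \esum_(tu in setT)
  ((label_dist tu.1 tu.2)%:E * P [set z | (first s z, second s z) = tu])).
  rewrite -esum_sum; last by move=> tu s _ _; apply: mule_ge0.
  rewrite -esumZl//; last first.
    by move=> tu; apply: sume_ge0 => s _; apply: mule_ge0.
  apply: eq_esum => -[t u] _; rewrite setTI.
  rewrite [X in _ * X = _](_ : _ = theta t u); last exact: piE.
  by rewrite /theta muleCA ge0_sume_distrr.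
(* the shuffle by s leaves the distance of the two families unchanged *)
transitivity (cS%:E *
  \sum_(s : 'S_N) \int[P]_z (best_dist (p z.1) (p z.2))%:E).
  congr (_ * _); apply: eq_bigr => s _.
  have := integral_fibers P (g := fun tu : T * T => (label_dist tu.1 tu.2)%:E)
    (mpair s) measurableT ldist0.
  rewrite (eq_integral
    (fun z : B => (best_dist (p z.1) (p z.2))%:E)); last first.
    by move=> z _; rewrite label_dist_permute.
  by move=> ->; apply: eq_esum => tu _; rewrite setTI.
rewrite (eq_bigr (fun=> 1%:E * \int[P]_z (best_dist (p z.1) (p z.2))%:E)).
  rewrite -ge0_sume_distrl// sumEFin sumr_const muleA -EFinM mulVf ?mul1e//.
  by rewrite pnatr_eq0 -lt0n card_Sn fact_gt0.
by move=> s _; rewrite mul1e.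
Qed.

(** The inequality between the integrands is only known where p returns the
    type of a measure, which holds almost surely because Pi has empirical laws
    as marginals. *)
Lemma integral_best_dist_le :
  \int[Pi]_(z in [set: B]) (best_dist (p z.1) (p z.2))%:E <=
  \int[Pi]_(z in [set: B]) W1 z.1 z.2 + e%:E.
Proof.
(* the measures that have a type at all *)
pose good : set (borelType (Prob R Et)) := [set mu | has_type q mu (p mu)].
have mgood : measurable good.
  rewrite (_ : good =
      \bigcup_t (p @^-1` [set t] `&` [set mu | has_type q mu t])).
    apply: countable_bigcupT_measurable; first exact: countableP.
    move=> t; apply: measurableI; first exact: mp.
    exact: (measurable_has_type cq t).
  apply/seteqP; split => mu; first by exists (p mu).
  by move=> [t _ [/= <-]].
have emp_good (H : Prob R EN) : empirical_law N0 H (~` good) = 0.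
  rewrite -[RHS](@measure0 _ (borelType EN) R H).
  congr (H _); apply/seteqP; split => // X; apply; exact: pX.
pose good2 : set B := fst @^-1` good `&` snd @^-1` good.
have mgood2 : measurable good2.
  by apply: measurableI; [exact: borel_fst mgood|exact: borel_snd mgood].
have bgoodC : borel (~` good) by exact: measurableC mgood.
have good2C : P (~` good2) = 0.
  rewrite setCI.
  apply: etrans (measureU0 (borel_fst bgoodC) (borel_snd bgoodC) _) _.
    exact: etrans (Pi2 bgoodC) (emp_good G).
  exact: etrans (Pi1 bgoodC) (emp_good F).
pose excess (z : B) := (Num.max 0 (best_dist (p z.1) (p z.2) - e))%:E.
have excess0 z : 0 <= excess z by rewrite lee_fin le_max lexx.
have mbest : measurable_fun setT (fun z : B => (best_dist (p z.1) (p z.2))%:E).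
  exact: (measurable_fun_fibers (fun tu => (best_dist tu.1 tu.2)%:E)
    (measurable_fibers_pair mp1 mp2)).
have mexcess : measurable_fun setT excess.
  exact: (measurable_fun_fibers
    (fun tu => (Num.max 0 (best_dist tu.1 tu.2 - e))%:E)
    (measurable_fibers_pair mp1 mp2)).
apply: (@le_trans _ _ (\int[P]_z (excess z + e%:E))).
  apply: le_lower_integral => z; first by rewrite lee_fin label_dist_ge0.
  by rewrite -EFinD lee_fin -lerBlDr le_max lexx orbT.
rewrite (integral_addr_cst P e0 mexcess)//; apply: leeD2r.
rewrite (ge0_negligible_integral (measurableC mgood2))// setTD setCK.
rewrite integral_mkcond.
apply: le_lower_integral => z; first exact: erestrict_ge0.
rewrite patchE; case: ifPn => [/set_mem[g1 g2]|_]; last exact: W1_ge0.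
rewrite /excess EFin_max ge_max W1_ge0/=.
exact: best_dist_le_W1.
Qed.

End coupling_given.

Lemma W1_pow_le (Pi : Prob R (Prob R Et * Prob R Et)%type) :
  coupling (empirical_law N0 F) (empirical_law N0 G) Pi ->
  W1_pow F G <=
  \int[Pi]_(z in [set: borelType (Prob R Et * Prob R Et)%type]) W1 z.1 z.2
  + (e + e)%:E.
Proof.
move=> PiFG.
have [p [mp p_type]] := @measurable_choice _ (borelType (Prob R Et)) T
  (labels q point) (fun t => [set mu | has_type q mu t])
  (fun t => measurable_has_type cq t).
have [pi piFG costE] := exists_coupling_best_dist PiFG mp p_type.
pose Q : probability (borelType (EN * EN)%type) R := pi.
have mlab : measurable_fun setT (fun z : borelType (EN * EN)%type =>
    (label_dist (labels q z.1) (labels q z.2))%:E).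
  apply: (measurable_fun_fibers
    (a := fun z : borelType (EN * EN)%type => (labels q z.1, labels q z.2))
    (fun tu => (label_dist tu.1 tu.2)%:E)).
  apply: measurable_fibers_pair => k.
    exact: borel_fst (labels_fibers cq k).
  exact: borel_snd (labels_fibers cq k).
apply: (@le_trans _ _ (\int[Q]_z
    ((label_dist (labels q z.1) (labels q z.2))%:E + e%:E))).
  apply: (@le_trans _ _ (\int[Q]_z (normalized_dist z.1 z.2)%:E)).
    by apply: ereal_inf_lbound; exists pi.
  apply: le_lower_integral => z.
    rewrite lee_fin mulr_ge0 ?invr_ge0// sumr_ge0// => i _.
    exact: truncated_dist_ge0.
  by rewrite -EFinD lee_fin normalized_dist_le.
rewrite (integral_addr_cst Q e0 mlab) => [|z]; last first.
  by rewrite lee_fin label_dist_ge0.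
rewrite EFinD addeA; apply: leeD2r.
by have := integral_best_dist_le PiFG mp p_type; rewrite -costE.
Qed.

End wasserstein_le.

Theorem proposition14 (R : realType) (d N : nat) (N0 : (0 < N)%N)
    (E : set 'rV[R]_d) (E0 : (E !=set0)%classic) (clE : closed E)
    (F G : Prob R {ptws 'I_N -> nonempty_subset E0})
    (symF : symmetric_prob F) (symG : symmetric_prob G) :
  W1_pow F G = calW1 (empirical_law N0 F) (empirical_law N0 G).
Proof.
apply/eqP; rewrite eq_le calW1_empirical_le andbT.
apply: le_ereal_inf_tmp => _ [Pi PiFG <-]; apply/lee_addgt0Pr => e e0.
have [n osc] := cell_oscillation E0 (divr_gt0 e0 (ltr0n R 2)).
by have := W1_pow_le symF symG osc PiFG; rewrite -splitr.
Qed.
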